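(* Let $d\ge2$, let $\gamma:\mathbb{R}\to\mathbb{RP}^d$ be a smooth nondegenerate curve with monodromy, with normalized lift $\Gamma$ and periodic functions $u_0,\dots,u_{d-1}$. Let $\tilde L_{i,t}$, $\tilde P_{i,t}$, $D_\varepsilon$, $U$, $V$ be the matrices defined in the context. (i) (Limit of the Lax matrices.) As $\varepsilon\to0$, $$D_\varepsilon\tilde L_{0,0}D_\varepsilon^{-1}=I+\varepsilon U+O(\varepsilon^2),$$ where $U$ is the matrix corresponding to the differential operator $\partial^{d+1}+u_{d-1}\partial^{d-1}+\dots+u_0$ (evaluated at the point $x$). (ii) (Limit of the Lax equation.) The discrete Lax equation $\tilde L_{0,1}=\tilde P_{1,0}\tilde L_{0,0}\tilde P_{0,0}^{-1}$, rewritten as $$\frac{D_\varepsilon\tilde L_{0,1}D_\varepsilon^{-1}-D_\varepsilon\tilde L_{0,0}D_\varepsilon^{-1}}{\varepsilon^3}=\frac{(D_\varepsilon\tilde P_{1,0}D_\varepsilon^{-1})(D_\varepsilon\tilde L_{0,0}D_\varepsilon^{-1})(D_\varepsilon\tilde P_{0,0}D_\varepsilon^{-1})^{-1}-D_\varepsilon\tilde L_{0,0}D_\varepsilon^{-1}}{\varepsilon^3},$$ becomes, as $\varepsilon\to0$, the zero-curvature representation of the $(2,d+1)$-KdV equation $$\frac{d}{dt}U=[V,U]+\frac{d}{dx}V;$$ that is, the left-hand side converges to $\frac{d}{dt}U$ and the right-hand side converges to $[V,U]+\frac{d}{dx}V$.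
   Context: Write $\partial=\frac{d}{dx}$. A curve $\gamma:\mathbb{R}\to\mathbb{RP}^d$ has monodromy $M\in\mathrm{PGL}(d+1,\mathbb{R})$ if $\gamma(x+2\pi)=M\cdot\gamma(x)$ for all $x$; it is nondegenerate if $\gamma'(x),\dots,\gamma^{(d)}(x)$ are linearly independent for every $x$ in some (hence any) affine chart. Its normalized lift is a smooth lift $\Gamma$ to $\mathbb{R}^{d+1}$ with $\det(\Gamma,\Gamma',\dots,\Gamma^{(d)})\equiv1$ (which exists, after composing $\gamma$ with a projective transformation if necessary); it satisfies $\Gamma^{(d+1)}+u_{d-1}\Gamma^{(d-1)}+\dots+u_0\Gamma=0$ with smooth $2\pi$-periodic $u_i$. Short-diagonal map on a discretized curve. For fixed $x$ and small $\varepsilon>0$ put $v_i=\gamma(x+i\varepsilon)$. If $d=2\kappa+1$, let $P_i$ be the hyperplane through $v_{i-2\kappa},v_{i-2\kappa+2},\dots,v_{i+2\kappa}$ and $T_\varepsilon(\gamma)(x)=P_{-\kappa}\cap\dots\cap P_\kappa$. If $d=2\kappa$, let $P_i$ be the hyperplane through $v_{i-2\kappa+1},v_{i-2\kappa+3},\dots,v_{i+2\kappa-1}$ and $T_\varepsilon(\gamma)(x)=P_{-\kappa+1}\cap\dots\cap P_\kappa$. Let $\tilde\gamma_\varepsilon(x)=T_\varepsilon(\gamma)(x)$ for $d$ odd and $T_\varepsilon(\gamma)(x-\varepsilon/2)$ for $d$ even, and let $\tilde\Gamma_\varepsilon$ be its lift with $\det(\tilde\Gamma_\varepsilon,\dots,\tilde\Gamma_\varepsilon^{(d)})\equiv1$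 and $\tilde\Gamma_\varepsilon\to\Gamma$ as $\varepsilon\to0$. One has $\tilde\Gamma_\varepsilon=\Gamma+\varepsilon^2c\,Q_2\Gamma+O(\varepsilon^4)$ where $Q_2=\partial^2+\frac{2}{d+1}u_{d-1}$ and $c=\tilde C_d$ is a nonzero constant; this defines $c$. The curve $\tilde\Gamma_\varepsilon$ satisfies $L_\varepsilon\tilde\Gamma_\varepsilon=0$ with $L_\varepsilon=\partial^{d+1}+u_{d-1,\varepsilon}\partial^{d-1}+\dots+u_{0,\varepsilon}$ and $u_{i,\varepsilon}=u_i+\varepsilon^2w_i+O(\varepsilon^4)$; regarding $\varepsilon^2$ as time, the time derivative is by definition $\frac{d}{dt}u_i=w_i$, and $\frac{d}{dt}U$ is computed entrywise from this. Matrices (all $(d+1)\times(d+1)$; they act on columns whose entries are vectors of $\mathbb{R}^{d+1}$). Let $\Delta_\varepsilon\Gamma(x)=\Gamma(x+\varepsilon)-\Gamma(x)$. - $\tilde L_{0,0}$ is the matrix whose first $d$ rows are $(0\,|\,I_d)$ and whose last row is $(\tilde a_0,\tilde a_1,\dots,\tilde a_d)$, where $\tilde a_j=\tilde a_j(x,\varepsilon)$ are the unique coefficients (for small $\varepsilon$) with $\Gamma(x+(d+1)\varepsilon)=\sum_{j=0}^d\tilde a_j\Gamma(x+j\varepsilon)$. $\tilde L_{i,0}$ is obtained by replacing $x$ by $x+i\varepsilon$. - $\tilde P_{i,0}$ is the unique matrix sending the column $(\Gamma(x+i\varepsilon),\dots,\Gamma(x+(i+d)\varepsilon))^\top$ to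 $(\tilde\Gamma_\varepsilon(x+i\varepsilon),\dots,\tilde\Gamma_\varepsilon(x+(i+d)\varepsilon))^\top$. - $\tilde L_{i,t}$, $\tilde P_{i,t}$ for $t\ge1$ are defined inductively by replacing $\Gamma$ with $\tilde\Gamma_\varepsilon$ when $t\to t+1$. By construction $\tilde L_{i,t+1}=\tilde P_{i+1,t}\tilde L_{i,t}\tilde P_{i,t}^{-1}$. - $D_\varepsilon$ is the constant matrix such that $D_\varepsilon(\Gamma(x),\Gamma(x+\varepsilon),\dots,\Gamma(x+d\varepsilon))^\top=(\Gamma(x),\Delta_\varepsilon\Gamma(x)/\varepsilon,\dots,\Delta_\varepsilon^d\Gamma(x)/\varepsilon^d)^\top$, i.e. the matrix expressing $\Delta_\varepsilon^k/\varepsilon^k$ through shifts, $\Delta_\varepsilon^k\Gamma(x)=\sum_{i=0}^k(-1)^{k-i}\binom{k}{i}\Gamma(x+i\varepsilon)$. - $U$ is the matrix whose first $d$ rows are $(0\,|\,I_d)$ and whose last row is $(-u_0,-u_1,\dots,-u_{d-1},0)$, with $u_i=u_i(x)$. - $V=V(x)$ is the unique matrix with $V(\Gamma,\Gamma',\dots,\Gamma^{(d)})^\top=c\,(Q_2\Gamma,(Q_2\Gamma)',\dots,(Q_2\Gamma)^{(d)})^\top$. The matrix equation $\frac{d}{dt}U=[V,U]+\frac{d}{dx}V$ is the zero-curvature form of $\frac{d}{dt}L=c[Q_2,L]$, $L=\partial^{d+1}+u_{d-1}\partial^{d-1}+\dots+u_0$, i.e. of the $(2,d+1)$-KdV equation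 up to constant rescaling of time. *)

(* Defs.v *)
(* MathComp-Analysis, over an arbitrary [R : realType]. *)
From HB Require Import structures.
From mathcomp Require Import all_boot all_order all_algebra.
From mathcomp Require Import all_classical all_reals all_analysis.

Set Implicit Arguments.
Unset Strict Implicit.
Unset Printing Implicit Defensive.

Import Order.TTheory GRing.Theory Num.Theory.
Import numFieldNormedType.Exports.

Local Open Scope classical_set_scope.
Local Open Scope ring_scope.

(* Vectors of R^(d+1) are rows, so a "column whose entries are vectors" is a
   square matrix whose k-th row is the k-th vector, and a matrix acts on such a
   column by multiplication on the left. *)

Section Curves.
Variables (R : realType) (d : nat).

Definition smooth (V : normedModType R) (f : R -> V) : Prop :=
  forall (n : nat) (x : R), derivable (derive1n n f) x 1.

Definition RP : Type := {L : {vspace 'rV[R]_d.+1} | \dim L == 1%N}.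

Definition line_of (p : RP) : {vspace 'rV[R]_d.+1} := sval p.

(* The affine chart {v_k != 0}, with coordinates v_j / v_k for j != k; these
   do not depend on the chosen nonzero vector [vpick _] of the line. *)
Definition chart_dom (k : 'I_d.+1) (p : RP) : bool :=
  vpick (line_of p) 0 k != 0.

Definition chart (k : 'I_d.+1) (p : RP) : 'rV[R]_d :=
  \row_(j < d) (vpick (line_of p) 0 (lift k j) / vpick (line_of p) 0 k).

Definition smooth_curve (gamma : R -> RP) : Prop :=
  forall x : R, exists k : 'I_d.+1,
    (\forall y \near x, chart_dom k (gamma y)) /\
    (forall n : nat, \forall y \near x, derivable (derive1n n (chart k \o gamma)) y 1).

Definition nondegenerate_curve (gamma : R -> RP) : Prop :=
  forall x : R, exists k : 'I_d.+1,
    chart_dom k (gamma x) /\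
    row_free (\matrix_(i < d) derive1n i.+1 (chart k \o gamma) x).

(* M acts on the column vector v^T, i.e. by v |-> v *m M^T on rows. *)
Definition has_monodromy (gamma : R -> RP) : Prop :=
  exists2 M : 'M[R]_d.+1, M \in unitmx &
    forall x : R, line_of (gamma (x + 2 * pi)) =
      (linfun (mulmxr M^T) @: line_of (gamma x))%VS.

(* The column (G, G', ..., G^(d))^T at x. *)
Definition jet (G : R -> 'rV[R]_d.+1) (x : R) : 'M[R]_d.+1 :=
  \matrix_(k < d.+1) derive1n k G x.

(* The curve of lines is an arbitrary family of subspaces: the short-diagonal
   map below is such a family, and having a normalized lift forces all its
   values to be lines. *)
Definition normalized_lift (l : R -> {vspace 'rV[R]_d.+1})
    (G : R -> 'rV[R]_d.+1) : Prop :=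
  [/\ smooth G, (forall x, l x = <[G x]>%VS) & (forall x, \det (jet G x) = 1)].

(* Only u 0, ..., u d.-1 are relevant. *)
Definition solves_ode (u : nat -> R -> R) (G : R -> 'rV[R]_d.+1) : Prop :=
  forall x : R, derive1n d.+1 G x + \sum_(i < d) u i x *: derive1n i G x = 0.

Definition vertex (gamma : R -> RP) (eps x : R) (i : int) : RP :=
  gamma (x + i%:~R * eps).

(* The span of v_(i-(d-1)), v_(i-(d-1)+2), ..., v_(i+(d-1)). For d = 2k+1 the
   indices run from i-2k to i+2k, and for d = 2k from i-2k+1 to i+2k-1. *)
Definition diag_plane (gamma : R -> RP) (eps x : R) (i : int)
    : {vspace 'rV[R]_d.+1} :=
  (\sum_(j < d)
     line_of (vertex gamma eps x (i - d.-1%:Z + 2 * j%:Z)%R))%VS.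

(* The d planes P_i with i = m - floor((d-1)/2), 0 <= m < d: for d = 2k+1 this is
   -k <= i <= k, and for d = 2k it is -k+1 <= i <= k. *)
Definition short_diag (gamma : R -> RP) (eps x : R)
    : {vspace 'rV[R]_d.+1} :=
  (\bigcap_(m < d) diag_plane gamma eps x (m%:Z - (d.-1)./2%:Z))%VS.

Definition short_diag_centered (gamma : R -> RP) (eps x : R)
    : {vspace 'rV[R]_d.+1} :=
  short_diag gamma eps (if odd d then x else x - eps / 2).

(* [Gt eps] is the lift of the image curve; [Gamma] is the given lift of
   gamma. Convergence to [Gamma] only serves to fix the sign of [Gt eps]. *)
Definition evolved_lift (gamma : R -> RP) (Gamma : R -> 'rV[R]_d.+1)
    (Gt : R -> R -> 'rV[R]_d.+1) : Prop :=
  (\forall eps \near 0^'+,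
     normalized_lift (short_diag_centered gamma eps) (Gt eps)) /\
  (forall x : R, Gt eps x @[eps --> 0^'+] --> Gamma x).

Definition Q2 (u : nat -> R -> R) (G : R -> 'rV[R]_d.+1) (x : R)
    : 'rV[R]_d.+1 :=
  derive1n 2 G x + (2 / d.+1%:R * u d.-1 x) *: G x.

Definition evolution_constant (u : nat -> R -> R) (Gamma : R -> 'rV[R]_d.+1)
    (Gt : R -> R -> 'rV[R]_d.+1) (c : R) : Prop :=
  c != 0 /\
  forall x : R,
    (fun eps : R => Gt eps x - (Gamma x + eps ^+ 2 *: (c *: Q2 u Gamma x)))
      =O_ (0^'+) (fun eps : R => eps ^+ 4).

(* w i is the derivative of u i with respect to the time eps^2. *)
Definition time_derivative (u : nat -> R -> R) (Gt : R -> R -> 'rV[R]_d.+1)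
    (w : nat -> R -> R) : Prop :=
  exists2 ueps : R -> nat -> R -> R,
    (\forall eps \near 0^'+, solves_ode (ueps eps) (Gt eps)) &
    forall (i : nat) (x : R), (i < d)%N ->
      (fun eps : R => ueps eps i x - (u i x + eps ^+ 2 * w i x))
        =O_ (0^'+) (fun eps : R => eps ^+ 4).

End Curves.

Section Matrices.
Variables (R : realType) (d : nat).
Implicit Types (G : R -> 'rV[R]_d.+1) (eps x : R).

(* The matrix sending the column X to the column Y, see [sending_mxP]. *)
Definition sending_mx m (X : 'M[R]_d.+1) (Y : 'M[R]_(m, d.+1))
    : 'M[R]_(m, d.+1) := Y *m invmx X.

Lemma sending_mxP m (X : 'M[R]_d.+1) (Y A : 'M[R]_(m, d.+1)) :
  X \in unitmx -> A *m X = Y <-> A = sending_mx X Y.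
Proof. by move=> uX; split=> [<-|->]; rewrite /sending_mx (mulmxK, mulmxKV). Qed.

(* First d rows (0 | I_d), last row a. *)
Definition companion (a : 'rV[R]_d.+1) : 'M[R]_d.+1 :=
  \matrix_(i, j) if i == ord_max then a 0 j else (j == i.+1 :> nat)%:R.

(* The column (G(x), G(x + eps), ..., G(x + d eps))^T. *)
Definition samples G eps x : 'M[R]_d.+1 :=
  \matrix_(k < d.+1) G (x + k%:R * eps).

(* If [G t eps] is the lift at time t, then L_(i,t) is
   [lax_L (G t eps) eps x i] and P_(i,t) is
   [lax_P (G t eps) (G t.+1 eps) eps x i]. *)
Definition lax_L G eps x (i : nat) : 'M[R]_d.+1 :=
  let y := x + i%:R * eps in
  companion (sending_mx (samples G eps y) (G (y + d.+1%:R * eps))).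

Definition lax_P G G' eps x (i : nat) : 'M[R]_d.+1 :=
  let y := x + i%:R * eps in
  sending_mx (samples G eps y) (samples G' eps y).

Definition Dmx eps : 'M[R]_d.+1 :=
  \matrix_(k, i) ((-1) ^+ (k - i) * 'C(k, i)%:R / eps ^+ k).

Definition conjD eps (A : 'M[R]_d.+1) : 'M[R]_d.+1 :=
  Dmx eps *m A *m invmx (Dmx eps).

Definition Umx (u : nat -> R -> R) x : 'M[R]_d.+1 :=
  companion (\row_j (if (j < d)%N then - u j x else 0)).

(* The entrywise time derivative of [Umx u] when d/dt (u i) = w i. *)
Definition dtUmx (w : nat -> R -> R) x : 'M[R]_d.+1 :=
  \matrix_(i, j) if (i == ord_max) && (j < d)%N then - w j x else 0.

Definition Vmx (c : R) (u : nat -> R -> R) G x : 'M[R]_d.+1 :=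
  sending_mx (jet G x) (c *: jet (Q2 u G) x).

End Matrices.
Arguments Umx {R} d u x.
Arguments dtUmx {R} d w x.

(* Main.v *)
(* Everything is read off one fact: on compact sets of x, and with bounds on all
   x-derivatives, the evolved lift is Gamma + eps^2 h_eps with h_eps bounded.
   The hypotheses give only a pointwise expansion, whereas the Lax matrices
   evaluate the lift at moving points x + i eps, so this uniformity has to be
   extracted from the short-diagonal map itself.

   We work with families f(eps, x) that have finite Taylor expansions in eps
   with coefficients smooth in x and a remainder bounded with all its
   x-derivatives. Such families form an algebra closed under d/dx, inverses and
   shifts x -> x + t eps, and an expansion starting at eps^k may be divided by
   eps^k. Inverting a Vandermonde matrix, the span of d points
   Gamma(z + t_j eps) is the span of d families with leading terms
   Gamma^(a)(z), a < d, so its normal covector nu has an expansion whose leading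
   term is the dual curve. Applied to nu at the shifts s_m eps, the same
   argument shows that the intersection of the d planes is orthogonal to families with
   leading terms nu^(a), a < d, and hence has a direction with an expansion
   starting at Gamma. The determinant normalization passes the expansion to the
   lift, and the pointwise hypotheses kill its eps^1 term.

   Since h_eps is bounded with its derivatives and converges pointwise to
   H = c Q_2 Gamma, all its derivatives and divided differences converge. With
   J the jet matrix and S the matrix of divided differences of Gamma,
   conjD L = 1 + eps S' S^-1, where S' S^-1 -> J' J^-1 = U; and both dU/dt and
   the limit of the Lax equation are (J_H' - U J_H) J^-1, which equals
   [V,U] + dV/dx because V = J_H J^-1. *)
Require Import Defs.
From HB Require Import structures.
From mathcomp Require Import all_boot all_order all_algebra.
From mathcomp Require Import all_classical all_reals all_analysis.
From mathcomp Require Import ring lra.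

Set Implicit Arguments.
Unset Strict Implicit.
Unset Printing Implicit Defensive.

Import Order.TTheory GRing.Theory Num.Theory.
Import numFieldNormedType.Exports.

Local Open Scope classical_set_scope.
Local Open Scope ring_scope.

(** * Families bounded together with their derivatives *)

Section Families.
Variable R : realType.
Implicit Types (f g h : R -> R -> R) (P Q : R -> R -> Prop).

(** One threshold on [e] serves a whole bounded interval of [y]. This order of quantifiers is what
    survives evaluation at moving points [y + t * e] and differentiation in [y]. *)
Definition near_loc P := forall M : R,
  \forall e \near 0^'+, forall y : R, `|y| < M -> P e y.

Lemma near_loc_mono P Q : (forall e y, P e y -> Q e y) -> near_loc P ->
  near_loc Q.
Proof.
move=> PQ HP M; move: (HP M); apply: filterS => e He y yM.
exact/PQ/He.
Qed.

Lemma near_locI P Q : near_loc P -> near_loc Q ->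
  near_loc (fun e y => P e y /\ Q e y).
Proof.
move=> HP HQ M; move: (HP M) (HQ M); apply: filterS2 => e He He' y yM.
by split; [exact: He|exact: He'].
Qed.

Lemma near_loc_mono2 P Q (S : R -> R -> Prop) :
  (forall e y, P e y -> Q e y -> S e y) -> near_loc P -> near_loc Q ->
    near_loc S.
Proof.
by move=> PQ HP HQ; apply: near_loc_mono (near_locI HP HQ) => e y []; exact: PQ.
Qed.

Lemma near_locW P : (forall e y, P e y) -> near_loc P.
Proof. by move=> HP M; apply: nearW => e y _. Qed.

Lemma near_loc_near (P : R -> Prop) : (\forall e \near 0^'+, P e) ->
  near_loc (fun e _ => P e).
Proof. by move=> HP M; move: HP; apply: filterS. Qed.

Lemma near_loc_gt0 : near_loc (fun e _ => 0 < e).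
Proof. by apply: near_loc_near; exact: nbhs_right_gt. Qed.

Lemma near_loc_all (I : finType) (P : I -> R -> R -> Prop) :
  (forall i, near_loc (P i)) -> near_loc (fun e y => forall i, P i e y).
Proof.
move=> HP M; have /filter_forall : forall i, \forall e \near 0^'+,
  forall y, `|y| < M -> P i e y by move=> i; exact: HP.
by apply: filterS => e He y yM i; apply: He.
Qed.

Lemma near_shift_lt (M t : R) :
  \forall e \near 0^'+, forall y : R, `|y| < M -> `|y + t * e| < M + 1.
Proof.
have t1 : 0 < `|t| + 1 by rewrite ltr_wpDl.
have : 0 < (`|t| + 1)^-1 by rewrite invr_gt0.
move=> /nbhs_right_lt; move: (@nbhs_right_gt R 0).
apply: filterS2 => e e0; rewrite -[_^-1]mul1r ltr_pdivlMr // => et y yM.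
apply: le_lt_trans (ler_normD _ _) _; apply: ltrD => //.
rewrite normrM [`|e|]gtr0_norm //; apply: le_lt_trans et.
by rewrite mulrC ler_wpM2l ?lerDl // ltW.
Qed.

Lemma near_loc_shift P t : near_loc P -> near_loc (fun e y => P e (y + t * e)).
Proof.
move=> HP M; move: (near_shift_lt M t) (HP (M + 1)).
by apply: filterS2 => e Hs He y yM; apply/He/Hs.
Qed.

(** The condition [|y| < M] is open, so the threshold stays the same. Hence families equal for small
    [e] have equal derivatives in [y]. *)
Lemma near_loc_nbhs P : near_loc P ->
  near_loc (fun e y => \forall z \near y, P e z).
Proof.
move=> HP M; move: (HP M); apply: filterS => e He y yM.
have : \forall z \near y, `|z| < M.
  have := @norm_continuous _ R y; move/cvgr_lt => /(_ M yM); exact.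
by apply: filterS => z; exact: He.
Qed.

Lemma near_loc_pt P y : near_loc P -> \forall e \near 0^'+, P e y.
Proof.
by move=> /(_ (`|y| + 1)); apply: filterS => e; apply; rewrite ltrDl.
Qed.

Definition eq_near f g := near_loc (fun e y => f e y = g e y).

Lemma eq_near_refl f : eq_near f f. Proof. exact: near_locW. Qed.

Lemma eq_nearW f g : (forall e y, f e y = g e y) -> eq_near f g.
Proof. by move=> fg; apply: near_locW. Qed.

Lemma eq_near_gt0 f g : (forall e y, 0 < e -> f e y = g e y) -> eq_near f g.
Proof. by move=> fg; apply: near_loc_mono near_loc_gt0 => e y; exact: fg. Qed.

Lemma eq_near_sym f g : eq_near f g -> eq_near g f.
Proof. by apply: near_loc_mono => e y ->. Qed.

Lemma eq_near_trans g f h : eq_near f g -> eq_near g h -> eq_near f h.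
Proof. by apply: near_loc_mono2 => e y -> ->. Qed.

Definition bounded_near f := forall M : R, exists C : R,
  \forall e \near 0^'+, forall y, `|y| < M -> `|f e y| <= C.

Lemma bounded_near_eq_near f g : eq_near f g -> bounded_near f ->
  bounded_near g.
Proof.
move=> fg bf M; have [C HC] := bf M; exists C.
by move: (fg M) HC; apply: filterS2 => e He HC y yM; rewrite -He // HC.
Qed.

Lemma bounded_near_le f g : near_loc (fun e y => `|g e y| <= `|f e y|) ->
  bounded_near f -> bounded_near g.
Proof.
move=> fg bf M; have [C HC] := bf M; exists C.
move: (fg M) HC; apply: filterS2 => e He HC y yM.
by apply: le_trans (He _ yM) (HC _ yM).
Qed.

Lemma bounded_near_cst a : bounded_near (fun _ _ => a).
Proof. by move=> M; exists `|a|; apply: nearW. Qed.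

Lemma bounded_near_add f g : bounded_near f -> bounded_near g ->
  bounded_near (fun e y => f e y + g e y).
Proof.
move=> bf bg M; have [C HC] := bf M; have [D HD] := bg M; exists (C + D).
move: HC HD; apply: filterS2 => e HC HD y yM.
by apply: le_trans (ler_normD _ _) _; apply: lerD; [exact: HC|exact: HD].
Qed.

Lemma bounded_near_mul f g : bounded_near f -> bounded_near g ->
  bounded_near (fun e y => f e y * g e y).
Proof.
move=> bf bg M; have [C HC] := bf M; have [D HD] := bg M; exists (C * D).
move: HC HD; apply: filterS2 => e HC HD y yM.
by rewrite normrM ler_pM //; [exact: HC|exact: HD].
Qed.

Lemma bounded_near_id : bounded_near (fun e _ => e).
Proof.
move=> M; exists 1; move: (@nbhs_right_gt R 0) (@nbhs_right_le R 0 1 ltr01).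
by apply: filterS2 => e e0 e1 y _; rewrite gtr0_norm.
Qed.

(** The constants and thresholds may depend on the order of the derivative as well as on the
    interval, so differentiability is only required for small [e]. *)
Fixpoint bsmooth_upto k f : Prop := bounded_near f /\
  if k is k'.+1 then near_loc (fun e y => derivable (f e) y 1) /\
                     bsmooth_upto k' (fun e => derive1 (f e)) else True.

Lemma bsmooth_upto_bounded k f : bsmooth_upto k f -> bounded_near f.
Proof. by case: k => [|k] []. Qed.

Lemma derivable_is_derive (h : R -> R) (y : R) :
  derivable h y 1 -> is_derive y 1 h (derive1 h y).
Proof. by move=> /derivableP; rewrite derive1E. Qed.

Lemma is_derive_derive1 (h : R -> R) (y d : R) : is_derive y 1 h d ->
  derive1 h y = d.
Proof. by move=> hd; rewrite derive1E derive_val. Qed.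

Lemma bsmooth_upto_is_derive k f : bsmooth_upto k.+1 f ->
  near_loc (fun e y => is_derive y 1 (f e) (derive1 (f e) y)).
Proof.
by move=> [_ [+ _]]; apply: near_loc_mono => e y /derivable_is_derive.
Qed.

Lemma eq_near_derive1 f g : eq_near f g ->
  eq_near (fun e => derive1 (f e)) (fun e => derive1 (g e)).
Proof.
move=> /near_loc_nbhs; apply: near_loc_mono => e y fg.
by rewrite !derive1E; exact: near_eq_derive.
Qed.

Lemma bsmooth_upto_eq_near k f g : eq_near f g -> bsmooth_upto k f ->
  bsmooth_upto k g.
Proof.
elim: k f g => [|k IH] f g fg /=; first by move=> [? _]; split=> //;
  exact: bounded_near_eq_near fg _.
move=> [bf [df Bf]]; split; first exact: bounded_near_eq_near fg _.
split; last by apply: IH Bf; exact: eq_near_derive1.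
have /near_loc_nbhs fg' := fg; apply: near_loc_mono2 fg' df => e y;
  exact: near_eq_derivable.
Qed.

(** The derivative may be supplied by any formula valid for small [e]; closure under the algebraic
    operations then follows by induction on [k] from the usual rules of differentiation. *)
Lemma bsmooth_upto_step k f df : bounded_near f ->
  near_loc (fun e y => is_derive y 1 (f e) (df e y)) -> bsmooth_upto k df ->
    bsmooth_upto k.+1 f.
Proof.
move=> bf Hd Bd; split=> //; split.
  by apply: near_loc_mono Hd => e y [].
apply: bsmooth_upto_eq_near Bd; apply: near_loc_mono Hd => e y Hd; symmetry.
exact: is_derive_derive1.
Qed.

Lemma bsmooth_upto_leS k f : bsmooth_upto k.+1 f -> bsmooth_upto k f.
Proof.
elim: k f => [|k IH] f [bf [df Bf]]; first by split.
by split=> //; split=> //; apply: IH.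
Qed.

Lemma bsmooth_upto_cst k a : bsmooth_upto k (fun _ _ => a).
Proof.
elim: k a => [|k IH] a; first by split=> //; exact: bounded_near_cst.
by apply: (bsmooth_upto_step (bounded_near_cst a) _ (IH 0));
  apply: near_locW => e y; exact: is_derive_cst.
Qed.

Lemma bsmooth_upto_id k : bsmooth_upto k (fun e _ => e).
Proof.
case: k => [|k]; first by split=> //; exact: bounded_near_id.
by apply: (bsmooth_upto_step bounded_near_id _ (bsmooth_upto_cst k 0));
  apply: near_locW => e y; exact: is_derive_cst.
Qed.

Lemma bsmooth_upto_add k f g : bsmooth_upto k f -> bsmooth_upto k g ->
  bsmooth_upto k (fun e y => f e y + g e y).
Proof.
elim: k f g => [|k IH] f g.
  by move=> [bf _] [bg _]; split=> //; exact: bounded_near_add.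
move=> Bf Bg; apply: (@bsmooth_upto_step _ _
  (fun e y => derive1 (f e) y + derive1 (g e) y)).
- by apply: bounded_near_add;
  [exact: bsmooth_upto_bounded Bf|exact: bsmooth_upto_bounded Bg].
- by apply: near_loc_mono2 (bsmooth_upto_is_derive Bf)
  (bsmooth_upto_is_derive Bg) => e y; exact: is_deriveD.
- by apply: IH; [case: Bf => _ []|case: Bg => _ []].
Qed.

Lemma bsmooth_upto_mul k f g : bsmooth_upto k f -> bsmooth_upto k g ->
  bsmooth_upto k (fun e y => f e y * g e y).
Proof.
elim: k f g => [|k IH] f g.
  by move=> [bf _] [bg _]; split=> //; exact: bounded_near_mul.
move=> Bf Bg; apply: (@bsmooth_upto_step _ _
  (fun e y => f e y * derive1 (g e) y + g e y * derive1 (f e) y)).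
- by apply: bounded_near_mul;
  [exact: bsmooth_upto_bounded Bf|exact: bsmooth_upto_bounded Bg].
- by apply: near_loc_mono2 (bsmooth_upto_is_derive Bf)
  (bsmooth_upto_is_derive Bg) => e y; exact: is_deriveM.
- have [_ [_ Bf']] := Bf; have [_ [_ Bg']] := Bg.
  by apply: bsmooth_upto_add; apply: IH => //; exact: bsmooth_upto_leS.
Qed.

Lemma is_deriveV (h : R -> R) (y d : R) : h y != 0 -> is_derive y 1 h d ->
  is_derive y 1 (fun z => (h z)^-1) (- (h y)^-1 * (h y)^-1 * d).
Proof.
move=> h0 hd; have dh : derivable h y 1 by case: hd.
apply: DeriveDef; first exact: derivableV.
by rewrite deriveV // derive_val /GRing.scale /= -exprVn expr2 !mulNr.
Qed.

(** The derivative [-f'/f^2] is a product of [f'] with copies of [1/f], so regularity of [1/f] to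
    order [k] gives order [k + 1]; a bound on [1/f] starts the induction. *)
Lemma bsmooth_upto_inv k f : near_loc (fun e y => f e y != 0) ->
  bounded_near (fun e y => (f e y)^-1) ->
  bsmooth_upto k f -> bsmooth_upto k (fun e y => (f e y)^-1).
Proof.
move=> f0 bV; elim: k f f0 bV => [|k IH] f f0 bV Bf; first by split.
have bsmooth_inv : bsmooth_upto k (fun e y => (f e y)^-1) by apply: IH => //;
  exact: bsmooth_upto_leS.
apply: (@bsmooth_upto_step _ _ (fun e y =>
  - 1 * (f e y)^-1 * (f e y)^-1 * derive1 (f e) y)) => //.
  apply: near_loc_mono2 f0 (bsmooth_upto_is_derive Bf) =>
    e y f0 /(is_deriveV f0).
  by rewrite mulN1r.
case: Bf => _ [_ Bf'].
by do 3![apply: bsmooth_upto_mul => //]; exact: bsmooth_upto_cst.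
Qed.

Lemma is_derive_translate (h : R -> R) (y t d : R) : is_derive (y + t) 1 h d ->
  is_derive y 1 (fun z => h (z + t)) d.
Proof.
move=> hd; rewrite -[d]mulr1.
by apply: (@is_derive1_comp _ h (fun z => z + t) y); exact: is_derive_shift.
Qed.

Definition bsmooth f := forall k, bsmooth_upto k f.

Lemma bsmooth_bounded f : bsmooth f -> bounded_near f.
Proof. by move/(_ 0)/bsmooth_upto_bounded. Qed.

Lemma bsmooth_eq_near f g : eq_near f g -> bsmooth f -> bsmooth g.
Proof. by move=> fg Bf k; exact: bsmooth_upto_eq_near fg _. Qed.

Lemma bsmooth_cst a : bsmooth (fun _ _ => a).
Proof. by move=> k; exact: bsmooth_upto_cst. Qed.
Lemma bsmooth_id : bsmooth (fun e _ => e).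
Proof. by move=> k; exact: bsmooth_upto_id. Qed.

Lemma bsmooth_add f g : bsmooth f -> bsmooth g ->
  bsmooth (fun e y => f e y + g e y).
Proof. by move=> Bf Bg k; exact: bsmooth_upto_add. Qed.

Lemma bsmooth_mul f g : bsmooth f -> bsmooth g ->
  bsmooth (fun e y => f e y * g e y).
Proof. by move=> Bf Bg k; exact: bsmooth_upto_mul. Qed.

Lemma bsmooth_derive1 f : bsmooth f -> bsmooth (fun e => derive1 (f e)).
Proof. by move=> Bf k; case: (Bf k.+1) => _ []. Qed.

Lemma bsmooth_derive1n n f : bsmooth f -> bsmooth (fun e => derive1n n (f e)).
Proof. by move=> Bf; elim: n => [|n IH] //; exact: bsmooth_derive1. Qed.

Lemma bsmooth_is_derive f : bsmooth f ->
  near_loc (fun e y => is_derive y 1 (f e) (derive1 (f e) y)).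
Proof. by move/(_ 1); exact: bsmooth_upto_is_derive. Qed.

Lemma bsmooth_inv f : near_loc (fun e y => f e y != 0) ->
  bounded_near (fun e y => (f e y)^-1) ->
  bsmooth f -> bsmooth (fun e y => (f e y)^-1).
Proof. by move=> f0 bV Bf k; exact: bsmooth_upto_inv. Qed.

End Families.
(** * Expansions in the step *)

Section Expansions.
Variable R : realType.
Implicit Types (f g h : R -> R -> R) (c : R -> R).

Lemma bsmooth_scale a f : bsmooth f -> bsmooth (fun e y => a * f e y).
Proof. by move=> Bf; apply: bsmooth_mul => //; exact: bsmooth_cst. Qed.

Lemma bsmooth_sum (I : Type) (r : seq I) (P : pred I) (F : I -> R -> R -> R) :
  (forall i, bsmooth (F i)) -> bsmooth (fun e y => \sum_(i <- r | P i) F i e y).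
Proof.
move=> BF; elim: r => [|i r IH].
  by apply: (bsmooth_eq_near _ (bsmooth_cst 0)); apply: eq_nearW => e y;
    rewrite big_nil.
apply: (@bsmooth_eq_near _ (fun e y => (if P i then F i e y else 0) +
    \sum_(i <- r | P i) F i e y)).
  by apply: eq_nearW => e y; rewrite big_cons; case: ifP => // _; rewrite add0r.
by apply: bsmooth_add => //; case: (P i) => //; exact: bsmooth_cst.
Qed.

(** A Taylor polynomial of degree below [m] in [e], in Horner form, with remainder [e^m] times a
    family bounded with all its derivatives. *)
Fixpoint expandable m f : Prop := if m is m'.+1 then
  exists c, exists g, [/\ bsmooth (fun _ => c), expandable m' g &
    eq_near f (fun e y => c y + e * g e y)] else bsmooth f.

(** Here [m] counts the orders available beyond the leading coefficient [c], which is kept visible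
    because the limits are read off it. *)
Definition expands_to m c f := bsmooth (fun _ => c) /\
  exists2 g, expandable m g & eq_near f (fun e y => c y + e * g e y).

Lemma expands_to_expandable m c f : expands_to m c f -> expandable m.+1 f.
Proof. by move=> [Bc [g Ag fg]]; exists c, g. Qed.

Lemma expands_to_lead_bsmooth m c f : expands_to m c f -> bsmooth (fun _ => c).
Proof. by case. Qed.

Lemma expandable_eq_near m f g : eq_near f g -> expandable m f ->
  expandable m g.
Proof.
case: m => [|m] fg /=; first exact: bsmooth_eq_near.
move=> [c [k [Bc Ak fk]]]; exists c, k; split=> //.
exact: eq_near_trans (eq_near_sym fg) fk.
Qed.

Lemma expands_to_eq_near m c f g : eq_near f g -> expands_to m c f ->
  expands_to m c g.
Proof.
move=> fg [Bc [k Ak fk]]; split=> //; exists k => //.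
exact: eq_near_trans (eq_near_sym fg) fk.
Qed.

Lemma expandable_lead m c : bsmooth (fun _ => c) -> expandable m (fun _ => c).
Proof.
elim: m c => [|m IH] c Bc //=; exists c, (fun _ _ => 0); split=> //.
  by apply: IH; exact: bsmooth_cst.
by apply: eq_nearW => e y; rewrite mulr0 addr0.
Qed.

Lemma expandable_cst m a : expandable m (fun _ _ => a).
Proof. by apply: expandable_lead; exact: bsmooth_cst. Qed.

Lemma expands_to_lead m c : bsmooth (fun _ => c) -> expands_to m c (fun _ => c).
Proof.
move=> Bc; split=> //; exists (fun _ _ => 0); first exact: expandable_cst.
by apply: eq_nearW => e y; rewrite mulr0 addr0.
Qed.

Lemma expands_to_id m f : expandable m f ->
  expands_to m (fun=> 0) (fun e y => e * f e y).
Proof.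
move=> Af; split; first exact: bsmooth_cst.
by exists f => //; apply: eq_nearW => e y; rewrite add0r.
Qed.

Lemma expandable_leS m f : expandable m.+1 f -> expandable m f.
Proof.
elim: m f => [|m IH] f [c [g [Bc Ag fg]]].
  by apply: bsmooth_eq_near (eq_near_sym fg) _; apply: bsmooth_add => //;
    apply: bsmooth_mul => //; exact: bsmooth_id.
by exists c, g; split=> //; exact: IH.
Qed.

Lemma expands_to_leS m c f : expands_to m.+1 c f -> expands_to m c f.
Proof.
by move=> [Bc [g Ag fg]]; split=> //; exists g => //; exact: expandable_leS.
Qed.

Lemma expandable_bsmooth m f : expandable m f -> bsmooth f.
Proof. by elim: m => [//|m IH] /expandable_leS. Qed.

Lemma expands_to_bsmooth m c f : expands_to m c f -> bsmooth f.
Proof. by move/expands_to_expandable/expandable_bsmooth. Qed.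

Lemma expandable_add m f g : expandable m f -> expandable m g ->
  expandable m (fun e y => f e y + g e y).
Proof.
elim: m f g => [|m IH] f g /=; first exact: bsmooth_add.
move=> [c [k [Bc Ak fk]]] [c' [k' [Bc' Ak' gk']]].
exists (fun y => c y + c' y), (fun e y => k e y + k' e y); split.
- exact: bsmooth_add.
- exact: IH.
- by apply: near_loc_mono2 fk gk' => e y -> ->; ring.
Qed.

Lemma expands_to_add m c c' f g : expands_to m c f -> expands_to m c' g ->
  expands_to m (fun y => c y + c' y) (fun e y => f e y + g e y).
Proof.
move=> [Bc [k Ak fk]] [Bc' [k' Ak' gk']]; split; first exact: bsmooth_add.
exists (fun e y => k e y + k' e y); first exact: expandable_add.
by apply: near_loc_mono2 fk gk' => e y -> ->; ring.
Qed.

Lemma expandable_mul m f g : expandable m f -> expandable m g ->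
  expandable m (fun e y => f e y * g e y).
Proof.
elim: m f g => [|m IH] f g /=; first exact: bsmooth_mul.
move=> [c [k [Bc Ak fk]]] [c' [k' [Bc' Ak' gk']]].
exists (fun y => c y * c' y),
  (fun e y => (c y * k' e y + k e y * c' y) + e * (k e y * k' e y)); split.
- exact: bsmooth_mul.
- apply: expandable_add; first by apply: expandable_add; apply: IH => //;
  exact: expandable_lead.
  by apply/expandable_leS/expands_to_expandable/expands_to_id/IH.
- by apply: near_loc_mono2 fk gk' => e y -> ->; ring.
Qed.

Lemma expands_to_mul m c c' f g : expands_to m c f -> expands_to m c' g ->
  expands_to m (fun y => c y * c' y) (fun e y => f e y * g e y).
Proof.
move=> [Bc [k Ak fk]] [Bc' [k' Ak' gk']]; split; first exact: bsmooth_mul.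
exists (fun e y => (c y * k' e y + k e y * c' y) + e * (k e y * k' e y)).
- apply: expandable_add; first by apply: expandable_add;
  apply: expandable_mul => //; exact: expandable_lead.
  by apply/expandable_leS/expands_to_expandable/expands_to_id/expandable_mul.
- by apply: near_loc_mono2 fk gk' => e y -> ->; ring.
Qed.

Lemma expandable_scale m a f : expandable m f ->
  expandable m (fun e y => a * f e y).
Proof. by move=> Af; apply: expandable_mul => //; exact: expandable_cst. Qed.

Lemma expands_to_scale m a c f : expands_to m c f ->
  expands_to m (fun y => a * c y) (fun e y => a * f e y).
Proof.
by apply: expands_to_mul; apply: expands_to_lead; exact: bsmooth_cst.
Qed.

Lemma expands_to_ext m c c' f : (forall y, c y = c' y) -> expands_to m c f ->
  expands_to m c' f.
Proof. by move=> cc'; have -> : c = c' by apply/funext. Qed.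

Lemma expands_to_sum m (I : Type) (r : seq I) (P : pred I) (c : I -> R -> R) F :
  (forall i, expands_to m (c i) (F i)) ->
  expands_to m (fun y => \sum_(i <- r | P i) c i y) (fun e y =>
    \sum_(i <- r | P i) F i e y).
Proof.
move=> EF; elim: r => [|i r IH].
  apply: (@expands_to_ext _ (fun=> 0)); first by move=> y; rewrite big_nil.
  by apply: (expands_to_eq_near _ (expands_to_lead m (bsmooth_cst 0)));
    apply: eq_nearW => e y; rewrite big_nil.
apply: (@expands_to_ext _ (fun y =>
  (if P i then c i y else 0) + \sum_(i <- r | P i) c i y)).
  by move=> y; rewrite big_cons; case: ifP => // _; rewrite add0r.
apply: (@expands_to_eq_near _ _ (fun e y => (if P i then F i e y else 0) +
    \sum_(i <- r | P i) F i e y)).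
  by apply: eq_nearW => e y; rewrite big_cons; case: ifP => // _; rewrite add0r.
by apply: expands_to_add => //; case: (P i) => //; apply: expands_to_lead;
  exact: bsmooth_cst.
Qed.

Lemma expands_to_prod m (I : Type) (r : seq I) (P : pred I) (c : I -> R ->
  R) F :
  (forall i, expands_to m (c i) (F i)) ->
  expands_to m (fun y => \prod_(i <- r | P i) c i y) (fun e y =>
    \prod_(i <- r | P i) F i e y).
Proof.
move=> EF; elim: r => [|i r IH].
  apply: (@expands_to_ext _ (fun=> 1)); first by move=> y; rewrite big_nil.
  by apply: (expands_to_eq_near _ (expands_to_lead m (bsmooth_cst 1)));
    apply: eq_nearW => e y; rewrite big_nil.
apply: (@expands_to_ext _ (fun y =>
  (if P i then c i y else 1) * \prod_(i <- r | P i) c i y)).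
  by move=> y; rewrite big_cons; case: ifP => // _; rewrite mul1r.
apply: (@expands_to_eq_near _ _ (fun e y => (if P i then F i e y else 1) *
    \prod_(i <- r | P i) F i e y)).
  by apply: eq_nearW => e y; rewrite big_cons; case: ifP => // _; rewrite mul1r.
by apply: expands_to_mul => //; case: (P i) => //; apply: expands_to_lead;
  exact: bsmooth_cst.
Qed.

Lemma expandable_sum m (I : Type) (r : seq I) (P : pred I) (F : I -> R -> R ->
  R) :
  (forall i, expandable m (F i)) ->
    expandable m (fun e y => \sum_(i <- r | P i) F i e y).
Proof.
move=> BF; elim: r => [|i r IH].
  by apply: (expandable_eq_near _ (expandable_cst m 0));
    apply: eq_nearW => e y; rewrite big_nil.
apply: (@expandable_eq_near _ (fun e y => (if P i then F i e y else 0) +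
    \sum_(i <- r | P i) F i e y)).
  by apply: eq_nearW => e y; rewrite big_cons; case: ifP => // _; rewrite add0r.
by apply: expandable_add => //; case: (P i) => //; exact: expandable_cst.
Qed.

Lemma eq_near_derive1_expand c f g : bsmooth (fun _ => c) -> bsmooth g ->
  eq_near f (fun e y => c y + e * g e y) ->
  eq_near (fun e => derive1 (f e)) (fun e y =>
    derive1 c y + e * derive1 (g e) y).
Proof.
move=> Bc Bg /eq_near_derive1 fg; apply: eq_near_trans fg _.
apply: near_loc_mono2 (bsmooth_is_derive Bc) (bsmooth_is_derive Bg) =>
  e y dc dg.
exact: is_derive_derive1.
Qed.

Lemma expandable_derive1 m f : expandable m f ->
  expandable m (fun e => derive1 (f e)).
Proof.
elim: m f => [|m IH] f /=; first exact: bsmooth_derive1.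
move=> [c [g [Bc Ag fg]]]; exists (derive1 c), (fun e => derive1 (g e)); split.
- exact: bsmooth_derive1 Bc.
- exact: IH.
- apply: eq_near_derive1_expand fg => //; exact: expandable_bsmooth Ag.
Qed.

Lemma expands_to_derive1 m c f : expands_to m c f ->
  expands_to m (derive1 c) (fun e => derive1 (f e)).
Proof.
move=> [Bc [g Ag fg]]; split; first exact: bsmooth_derive1 Bc.
exists (fun e => derive1 (g e)); first exact: expandable_derive1.
by apply: eq_near_derive1_expand fg => //; exact: expandable_bsmooth Ag.
Qed.

Lemma expands_to_derive1n m n c f : expands_to m c f ->
  expands_to m (derive1n n c) (fun e => derive1n n (f e)).
Proof. by move=> Af; elim: n => [|n IH] //; exact: expands_to_derive1. Qed.

Lemma near_ex (S : R -> Prop) : (\forall e \near 0^'+, S e) ->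
  exists e : R, S e.
Proof. exact: (@filter_ex _ _ (at_right_proper_filter (0 : R))). Qed.

Lemma bsmooth_derivable c (y : R) : bsmooth (fun _ => c) -> derivable c y 1.
Proof. by move=> /bsmooth_is_derive/(near_loc_pt y)/near_ex[e []]. Qed.

Lemma bounded_below c : bsmooth (fun _ => c) -> (forall y, c y != 0) ->
  forall M, exists2 k, 0 < k & forall y, `|y| < M -> k <= `|c y|.
Proof.
move=> Bc c0 M.
have cc : continuous (fun y => `|c y|).
  move=> y; apply: cvg_norm.
  exact/differentiable_continuous/derivable1_diffP/bsmooth_derivable.
(* [M] may be negative, so the extremum is taken on the interval from [-|M|] to [|M|]. *)
have MM : - `|M| <= `|M| by rewrite ge0_cp.
have [y yM Hy] := EVT_min MM (continuous_subspaceT cc).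
exists `|c y|; first by rewrite normr_gt0.
move=> z zM; apply: Hy; rewrite in_itv /= -ler_norml ltW //.
exact: lt_le_trans zM (ler_norm _).
Qed.

(** Once [e * |g|] is at most half of the lower bound of [|c|], at least half of that bound is left
    for [|f|]. *)
Lemma bounded_belowD c f g : bsmooth (fun _ => c) -> (forall y, c y != 0) ->
  bounded_near g ->
  eq_near f (fun e y => c y + e * g e y) ->
  forall M, exists2 k, 0 < k & \forall e \near 0^'+,
    forall y, `|y| < M -> k <= `|f e y|.
Proof.
move=> Bc c0 bg fg M; have [k k0 Hk] := bounded_below Bc c0 M.
exists (k / 2); first by rewrite divr_gt0.
have [C HC] := bg M.
have : 0 < k / 2 / (`|C| + 1) by rewrite !divr_gt0 // ltr_wpDl.
move=> /(@nbhs_right_lt R) He; near=> e => y yM.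
have -> : f e y = c y + e * g e y by move: y yM; near: e; exact: fg.
have e0 : 0 < e by near: e; exact: nbhs_right_gt.
have gC : `|g e y| <= C by move: y yM; near: e; exact: HC.
have ee : e < k / 2 / (`|C| + 1) by near: e; exact: He.
have ck := Hk _ yM.
have : `|e * g e y| <= k / 2.
  rewrite normrM (gtr0_norm e0) //.
  have C1 : 0 < `|C| + 1 by rewrite ltr_wpDl.
  move: ee; rewrite ltr_pdivlMr // => /ltW; apply: le_trans.
  apply: ler_wpM2l; first exact: ltW.
  by apply: le_trans gC _; apply: le_trans (ler_norm _) _; rewrite lerDl.
have := lerB_normD (c y) (e * g e y); lra.
Unshelve. all: end_near. Qed.

Lemma nonvanish c f g : bsmooth (fun _ => c) -> (forall y, c y != 0) ->
  bounded_near g ->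
  eq_near f (fun e y => c y + e * g e y) ->
  near_loc (fun e y => f e y != 0) /\ bounded_near (fun e y => (f e y)^-1).
Proof.
move=> Bc c0 bg fg; split=> M.
  have [k k0] := bounded_belowD Bc c0 bg fg M.
  apply: filterS => e He y /He; rewrite -normr_gt0; exact: lt_le_trans.
have [k k0 Hk] := bounded_belowD Bc c0 bg fg M.
exists k^-1; move: Hk; apply: filterS => e He y /He kf.
by rewrite normfV lef_pV2 // posrE // (lt_le_trans k0).
Qed.

(** From [f = c + e g] one gets [1/f = 1/c - e g / (c f)], so each order known for [1/f] yields the
    next one. The induction starts from the boundedness of [1/f] given by [nonvanish]. *)
Lemma expands_to_inv m c f : (forall y, c y != 0) -> expands_to m c f ->
  expands_to m (fun y => (c y)^-1) (fun e y => (f e y)^-1).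
Proof.
move=> c0; have c_inv : bsmooth (fun _ : R => c) ->
  bsmooth (fun (_ : R) y => (c y)^-1).
  move=> Bc; have [] := @nonvanish c (fun _ => c) (fun _ _ => 0) Bc c0.
  - exact: bounded_near_cst.
  - by apply: eq_nearW => e y; rewrite mulr0 addr0.
  - by move=> nz bi; apply: bsmooth_inv.
have step n g : expandable n g -> expandable n (fun e y => (f e y)^-1) ->
  bsmooth (fun _ => c) ->
    eq_near f (fun e y => c y + e * g e y) ->
    expands_to n (fun y => (c y)^-1) (fun e y => (f e y)^-1).
  move=> Ag AVf Bc fg; split; first exact: c_inv.
  exists (fun e y => -1 * (g e y * ((c y)^-1 * (f e y)^-1))).
    apply: expandable_scale; apply: expandable_mul => //;
      apply: expandable_mul => //.
    by apply: expandable_lead; exact: c_inv.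
  have [nz _] := nonvanish Bc c0 (bsmooth_bounded (expandable_bsmooth Ag)) fg.
  apply: near_loc_mono2 nz fg => e y nz fE; have := c0 y; move: nz;
    rewrite fE => nz cn.
  by field; rewrite nz cn.
elim: m => [|m IH] Ef.
  have [Bc [g Ag fg]] := Ef; apply: (step _ g) => //.
  have [nz bi] := nonvanish Bc c0 (bsmooth_bounded Ag) fg.
  by apply: bsmooth_inv => //; exact: expands_to_bsmooth Ef.
have [Bc [g Ag fg]] := Ef; apply: (step _ g) => //.
by apply/expands_to_expandable/IH/expands_to_leS.
Qed.

End Expansions.
(** * Taylor remainders and collocation *)

Section Taylor.
Variable R : realType.
Implicit Types (f g : R -> R -> R) (h c : R -> R).

Definition taylor_rem n h (y s : R) : R :=
  h (y + s) - \sum_(a < n) s ^+ a / a`!%:R * derive1n a h y.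

Lemma is_derive_fsum n (F : 'I_n -> R -> R) (dF : 'I_n -> R) (y : R) :
  (forall i, is_derive y 1 (F i) (dF i)) ->
  is_derive y 1 (fun z => \sum_i F i z) (\sum_i dF i).
Proof.
move=> HF; have -> : (fun z => \sum_i F i z) = \sum_i F i.
  by apply/funext => z; rewrite fct_sumE.
exact: is_derive_sum.
Qed.

Lemma is_derive_taylor_rem n h (y s : R) :
  is_derive (y + s) 1 h (derive1 h (y + s)) ->
  is_derive s 1 (taylor_rem n.+1 h y) (taylor_rem n (derive1 h) y s).
Proof.
move=> hd.
have -> : taylor_rem n.+1 h y = fun s => h (y + s) -
    (h y + \sum_(a < n) s ^+ a.+1 / a.+1`!%:R * derive1n a (derive1 h) y).
  apply/funext => z; rewrite /taylor_rem big_ord_recl expr0 divr1 mul1r.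
  by congr (_ - (_ + _)); apply: eq_bigr => i _; rewrite derive1Sn.
rewrite /taylor_rem; apply: is_deriveB.
  have -> : (fun s => h (y + s)) = (fun s => h (s + y)).
    by apply/funext => z; rewrite addrC.
  by apply: is_derive_translate; rewrite addrC.
rewrite -[X in is_derive _ _ _ X]add0r; apply: is_deriveD.
apply: is_derive_fsum => i.
have Hx := @is_deriveX _ _ id i.+1 s 1 1 (is_derive_id _ _).
have := @is_deriveZ _ _ _ _ (derive1n i (derive1 h) y / i.+1`!%:R) s 1 _ Hx.
have -> : (derive1n i (derive1 h) y / i.+1`!%:R) \*: (@id R) ^+ i.+1 =
  (fun z : R => z ^+ i.+1 / i.+1`!%:R * derive1n i (derive1 h) y) :> (R -> R).
  by apply/funext => z /=; rewrite exprfctE /GRing.scale /=; ring.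
move=> /is_derive_eq; apply.
rewrite /GRing.scale /= mulr1 factS natrM invfM.
have i1 : i.+1%:R != 0 :> R by rewrite pnatr_eq0.
have i2 : i`!%:R != 0 :> R by rewrite pnatr_eq0 -lt0n fact_gt0.
by field; rewrite i2 addrC natr1 i1.
Qed.

(** Induction on [n] through the mean value theorem: the [s]-derivative of the remainder of order
    [n + 1] of [h] is the remainder of order [n] of [h']. *)
Lemma taylor_rem_bound n h (M C y s : R) : 0 <= C -> `|y| < M -> `|y + s| < M ->
  (forall k, (k < n)%N -> forall z, `|z| < M -> derivable (derive1n k h) z 1) ->
  (forall z, `|z| < M -> `|derive1n n h z| <= C) ->
  `|taylor_rem n h y s| <= C * `|s| ^+ n.
Proof.
move=> C0 yM; elim: n h s => [|n IH] h s ysM Hd HC.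
  by rewrite /taylor_rem big_ord0 subr0 expr0 mulr1; exact: HC.
(* By convexity the segment from [y] to [y + s] stays where the derivatives are controlled. *)
have seg (t : R) : 0 <= t -> t <= 1 -> `|y + t * s| < M.
  move=> t0 t1; have -> : y + t * s = (1 - t) * y + t * (y + s) by ring.
  apply: le_lt_trans (ler_normD _ _) _;
    rewrite !normrM (ger0_norm t0) ger0_norm ?subr_ge0 //.
  have [->|tn0] := eqVneq t 0; first by rewrite mul0r addr0 subr0 mul1r.
  have tp : 0 < t by rewrite lt0r tn0.
  have -> : M = (1 - t) * M + t * M by ring.
  apply: ler_ltD; last by rewrite ltr_pM2l.
  by rewrite ler_wpM2l ?subr_ge0 // ltW.
pose G (t : R) := taylor_rem n.+1 h y (t * s).
have dG (t : R) : 0 <= t -> t <= 1 ->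
    is_derive t 1 G (s * taylor_rem n (derive1 h) y (t * s)).
  move=> t0 t1; rewrite mulrC.
  apply: (@is_derive1_comp _ (taylor_rem n.+1 h y) (fun t => t * s));
    last first.
    have := @is_deriveZ _ _ _ (@id R) s t 1 1 (is_derive_id _ _).
    have -> : s \*: (@id R) = (fun t => t * s) by apply/funext => z /=;
      rewrite mulrC.
    by move=> /is_derive_eq; apply; rewrite /GRing.scale /= mulr1.
  apply: is_derive_taylor_rem; apply: derivable_is_derive.
  by apply: (Hd 0%N) => //; exact: seg.
have [||t t01 Gt] := @MVT _ G (fun t =>
  s * taylor_rem n (derive1 h) y (t * s)) 0 1 ltr01.
- move=> t; rewrite in_itv /= => /andP[t0 t1]; exact: dG (ltW t0) (ltW t1).
- apply: derivable_within_continuous => t; rewrite in_itv /= => /andP[t0 t1].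
  by case: (dG t t0 t1).
move: t01 Gt; rewrite in_itv /= => /andP[t0 t1].
have -> : G 0 = 0.
  rewrite /G /taylor_rem mul0r addr0 big_ord_recl expr0 divr1 mul1r big1 ?addr0
    ?subrr //.
  by move=> i _; rewrite exprS !mul0r.
rewrite /G mul1r subr0 subr0 mulr1 => ->.
rewrite normrM exprS mulrCA ler_wpM2l //.
apply: le_trans (IH (derive1 h) (t * s) _ _ _) _.
- exact: seg (ltW t0) (ltW t1).
- by move=> k kn z zM; rewrite -derive1Sn; apply: (Hd k.+1).
- by move=> z zM; rewrite -derive1Sn; apply: HC.
apply: ler_wpM2l => //; apply: lerXn2r; rewrite ?nnegrE //.
by rewrite normrM (gtr0_norm t0); apply: ler_piMl => //; exact: ltW.
Qed.

(** The remainder of the shift by [t * e], rescaled so that it stays bounded as [e] tends to 0. *)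
Definition taylor_quot n (t : R) f (e y : R) := taylor_rem n (f e) y (t * e)
  / e ^+ n.

Lemma bsmooth_derivable_upto n f : bsmooth f ->
  near_loc (fun e y => forall k, (k < n)%N -> derivable (derive1n k (f e)) y 1).
Proof.
move=> Bf; have := @near_loc_all _ 'I_n
  (fun i e y => derivable (derive1n i (f e)) y 1) _.
move=> H; apply: near_loc_mono (H _) => [e y Hk k kn|i];
  first exact: (Hk (Ordinal kn)).
by apply: near_loc_mono (bsmooth_is_derive (bsmooth_derive1n i Bf)) => e y [].
Qed.

Lemma taylor_quot_bounded n t f : bsmooth f -> bounded_near (taylor_quot n t f).
Proof.
move=> Bf M; have [C HC] := bsmooth_bounded (bsmooth_derive1n n Bf) (M + 1);
  exists (`|C| * `|t| ^+ n).
near=> e => y yM.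
have e0 : 0 < e by near: e; exact: nbhs_right_gt.
have yt : `|y + t * e| < M + 1 by move: y yM; near: e; exact: near_shift_lt.
rewrite /taylor_quot normrM normfV normrX (gtr0_norm e0).
rewrite ler_pdivrMr ?exprn_gt0 //.
apply: le_trans (@taylor_rem_bound n (f e) (M + 1) `|C| y (t * e) _ _ _ _ _)
  _ => //.
- by apply: lt_trans yM _; rewrite ltrDl.
- move=> k kn z zM; move: z zM k kn; near: e; exact: bsmooth_derivable_upto.
- move=> z zM; apply: le_trans (ler_norm C); move: z zM; near: e; exact: HC.
by rewrite normrM (gtr0_norm e0) exprMn mulrA.
Unshelve. all: end_near. Qed.

Lemma taylor_quot_is_derive n t f : bsmooth f ->
  near_loc (fun e y => is_derive y 1 (taylor_quot n t f e)
    (taylor_quot n t (fun e => derive1 (f e)) e y)).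
Proof.
move=> Bf; have H1 := near_loc_shift t (bsmooth_is_derive Bf).
apply: near_loc_mono2 H1 (bsmooth_derivable_upto n Bf) => e y H1 H2.
rewrite /taylor_quot; have ->
  : (fun y0 => taylor_rem n (f e) y0 (t * e) / e ^+ n) =
   (e ^+ n)^-1 \*: (fun y0 => taylor_rem n (f e) y0 (t * e)).
  by apply/funext => z; rewrite /= mulrC.
rewrite [X in is_derive _ _ _ X]mulrC; apply: is_deriveZ; rewrite /taylor_rem.
apply: is_deriveB; first exact: is_derive_translate.
apply: is_derive_fsum => i; apply: is_deriveZ.
rewrite -derive1Sn; apply: derivable_is_derive; exact: H2.
Qed.

(** Differentiation in [y] commutes with forming the rescaled remainder, so the bound applied to
    [f], [f'] and so on controls all its derivatives. *)
Lemma taylor_quot_bsmooth n t f : bsmooth f -> bsmooth (taylor_quot n t f).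
Proof.
move=> Bf k; elim: k f Bf => [|k IH] f Bf; first by split=> //;
  exact: taylor_quot_bounded.
apply: (bsmooth_upto_step (taylor_quot_bounded n t Bf)
  (taylor_quot_is_derive n t Bf)).
by apply: IH; exact: bsmooth_derive1.
Qed.

Lemma taylor_remS n h y s : taylor_rem n h y s = s ^+ n / n`!%:R * derive1n n h
  y + taylor_rem n.+1 h y s.
Proof. rewrite /taylor_rem big_ord_recr /=; ring. Qed.

Lemma taylor_quot_step n t f :
  eq_near (taylor_quot n t f) (fun e y =>
    t ^+ n / n`!%:R * derive1n n (f e) y + e * taylor_quot n.+1 t f e y).
Proof.
apply: eq_near_gt0 => e y e0; rewrite /taylor_quot taylor_remS exprS exprMn.
have en : e ^+ n != 0 by rewrite expf_neq0 // gt_eqF.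
have i2 : n`!%:R != 0 :> R by rewrite pnatr_eq0 -lt0n fact_gt0.
by field; rewrite en i2 gt_eqF.
Qed.

(** Splitting off the term of degree [n] leaves [e] times the quotient of order [n + 1], so a
    function independent of [e] gives expansions of every order. *)
Lemma taylor_quot_lead m n t c : bsmooth (fun _ => c) ->
  expandable m (taylor_quot n t (fun _ => c)).
Proof.
move=> Bc; elim: m n => [|m IH] n; first exact: taylor_quot_bsmooth.
exists (fun y => t ^+ n / n`!%:R * derive1n n c y),
  (taylor_quot n.+1 t (fun _ => c)); split.
- by apply: bsmooth_scale; exact: (bsmooth_derive1n n Bc).
- exact: IH.
- exact: taylor_quot_step.
Qed.

Lemma eq_near_derive1n_expand n c f g : bsmooth (fun _ => c) -> bsmooth g ->
  eq_near f (fun e y => c y + e * g e y) ->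
  eq_near (fun e => derive1n n (f e)) (fun e y =>
    derive1n n c y + e * derive1n n (g e) y).
Proof.
move=> Bc Bg fg; elim: n => [|n IH] //.
apply: (eq_near_derive1_expand _ _ IH); first exact: (bsmooth_derive1n n Bc).
exact: bsmooth_derive1n.
Qed.

Lemma taylor_quot_expand n t c f g : bsmooth (fun _ => c) -> bsmooth g ->
  eq_near f (fun e y => c y + e * g e y) ->
  eq_near (taylor_quot n t f) (fun e y => taylor_quot n t (fun _ =>
    c) e y + e * taylor_quot n t g e y).
Proof.
move=> Bc Bg fg.
have Hd : near_loc (fun e y => forall a : 'I_n, derive1n a (f e) y =
    derive1n a c y + e * derive1n a (g e) y).
  by apply: near_loc_all => a; exact: eq_near_derive1n_expand.
apply: near_loc_mono2 (near_loc_shift t fg) Hd => e y Hs Hd.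
rewrite /taylor_quot /taylor_rem Hs mulrA -mulrDl; congr (_ / _).
rewrite mulrBr addrACA -opprD; congr (_ - _).
rewrite mulr_sumr -big_split /=; apply: eq_bigr => i _; rewrite Hd; ring.
Qed.

(** The quotient is linear in [f]: the leading coefficient is covered by [taylor_quot_lead], and the
    rest [e * g] by induction on [m]. *)
Lemma taylor_quot_expandable m n t f : expandable m f ->
  expandable m (taylor_quot n t f).
Proof.
elim: m f => [|m IH] f; first exact: taylor_quot_bsmooth.
move=> [c [g [Bc Ag fg]]].
apply: expandable_eq_near (eq_near_sym (taylor_quot_expand n t Bc
  (expandable_bsmooth Ag) fg)) _.
apply: expandable_add; first exact: taylor_quot_lead.
by apply: expands_to_expandable (expands_to_id _); exact: IH.
Qed.

Lemma shift_taylor_quot n t f : eq_near (fun e y => f e (y + t * e))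
  (fun e y => \sum_(a < n) t ^+ a * (e ^+ a / a`!%:R * derive1n a (f e) y)
              + e ^+ n * taylor_quot n t f e y).
Proof.
apply: eq_near_gt0 => e y e0;
  rewrite /taylor_quot [e ^+ n * _]mulrC divfK ?expf_neq0 ?gt_eqF //.
rewrite /taylor_rem [RHS]addrC;
  under [X in _ = _ - X + _]eq_bigr do rewrite exprMn -!mulrA.
by under [X in _ = _ + X]eq_bigr do rewrite -!mulrA; rewrite subrK.
Qed.

Lemma expandable_exp m n f : expandable m f ->
  expandable m (fun e y => e ^+ n * f e y).
Proof.
move=> Af; elim: n => [|n IH].
  by apply: expandable_eq_near Af; apply: eq_nearW => e y; rewrite expr0 mul1r.
apply: (@expandable_eq_near _ _ (fun e y => e * (e ^+ n * f e y))).
  by apply: eq_nearW => e y; rewrite exprS mulrA.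
exact/expandable_leS/expands_to_expandable/expands_to_id.
Qed.

Lemma vandermonde_unit n (t : 'I_n -> R) : injective t ->
  (\matrix_(i, a < n) t i ^+ a) \in unitmx.
Proof.
move=> tI; rewrite -unitmx_tr.
have -> : (\matrix_(i, a < n) t i ^+ a)^T = Vandermonde n (\row_i t i).
  by apply/matrixP => i j; rewrite !mxE.
rewrite unitmxE det_Vandermonde unitfE; apply/prodf_neq0 => i _.
apply/prodf_neq0 => j ij; rewrite !mxE subr_eq0; apply: contraTneq ij => /tI ->.
by rewrite ltnn.
Qed.

(* The values at the nodes are recovered from n families by the Vandermonde
   matrix of the nodes; inverting it moves the Taylor remainders, of order
   e^n, into the coefficients of e^a with a < n. *)
Lemma collocation m n (t : 'I_n -> R) c f : injective t -> expands_to m c f ->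
  exists2 h : 'I_n -> R -> R -> R,
    (forall a : 'I_n, expands_to m (derive1n a c) (h a)) &
    forall i, eq_near (fun e y => f e (y + t i * e))
      (fun e y => \sum_(a < n) t i ^+ a * (e ^+ a / a`!%:R * h a e y)).
Proof.
move=> /vandermonde_unit; set V := (\matrix_(i, a) _) => uV Ef.
have ATf i : expandable m (taylor_quot n (t i) f)
  by apply: taylor_quot_expandable;
  exact: expandable_leS (expands_to_expandable Ef).
exists (fun (a : 'I_n) e y => derive1n a (f e) y + e * (e ^+ (n - a.+1) *
   (a`!%:R * \sum_i invmx V a i * taylor_quot n (t i) f e y))).
  move=> a; apply: (@expands_to_ext _ _ (fun y => derive1n a c y + 0)).
    by move=> y; rewrite addr0.
  apply: expands_to_add; first exact: expands_to_derive1n.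
  apply: expands_to_id; apply: expandable_exp; apply: expandable_scale;
    apply: expandable_sum => i; exact: expandable_scale.
move=> i; apply: eq_near_trans (shift_taylor_quot n (t i) f) _;
  apply: eq_nearW => e y.
have -> : taylor_quot n (t i) f e y = \sum_(a < n) t i ^+ a * \sum_(j < n)
  invmx V a j * taylor_quot n (t j) f e y.
  have VV k : \sum_(a < n) t i ^+ a * invmx V a k = (i == k)%:R.
    have /matrixP/(_ i k) := mulmxV uV; rewrite [RHS]mxE => <-; rewrite mxE.
    by apply: eq_bigr => a _; rewrite mxE.
  under eq_bigr do rewrite mulr_sumr.
  rewrite exchange_big /= (bigD1 i) //= [X in _ + X]big1 ?addr0 => [|j ji].
    by under eq_bigr do rewrite mulrA; rewrite -mulr_suml VV eqxx mul1r.
  under eq_bigr do rewrite mulrA.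
  by rewrite -mulr_suml VV eq_sym (negbTE ji) mul0r.
rewrite mulr_sumr -big_split /=; apply: eq_bigr => a _.
have i2 : a`!%:R != 0 :> R by rewrite pnatr_eq0 -lt0n fact_gt0.
have -> : e ^+ n = e ^+ a * (e * e ^+ (n - a.+1)).
  by rewrite -exprS -exprD; congr (_ ^+ _);
    rewrite -subSn // subSS subnKC // ltnW.
by field.
Qed.

End Taylor.

(** * Expansions of matrix families *)

Section MatrixExpansions.
Variable R : realType.

Definition mx_expands_to m p q (C : R -> 'M[R]_(p, q)) (F : R -> R ->
  'M[R]_(p, q)) :=
  forall i j, expands_to m (fun y => C y i j) (fun e y => F e y i j).

Lemma mx_expands_to_mul m p q r (C : R -> 'M[R]_(p, q)) (D : R ->
  'M[R]_(q, r)) F G :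
  mx_expands_to m C F -> mx_expands_to m D G ->
  mx_expands_to m (fun y => C y *m D y) (fun e y => F e y *m G e y).
Proof.
move=> EF EG i j.
apply: (@expands_to_ext _ _ (fun y => \sum_k C y i k * D y k j)) => [y|];
  first by rewrite mxE.
apply: (@expands_to_eq_near _ _ _ (fun e y => \sum_k F e y i k * G e y k j)).
  by apply: eq_nearW => e y; rewrite mxE.
by apply: expands_to_sum => k; exact: expands_to_mul.
Qed.

Lemma expands_to_det m n (C : R -> 'M[R]_n) F : mx_expands_to m C F ->
  expands_to m (fun y => \det (C y)) (fun e y => \det (F e y)).
Proof.
move=> EF; rewrite /determinant; apply: expands_to_sum => s;
  apply: expands_to_scale.
by apply: expands_to_prod => i.
Qed.

Lemma expands_to_cofactor m n (C : R -> 'M[R]_n) F i j : mx_expands_to m C F ->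
  expands_to m (fun y => cofactor (C y) i j) (fun e y => cofactor (F e y) i j).
Proof.
move=> EF; apply: expands_to_scale; apply: expands_to_det => k l.
apply: (@expands_to_ext _ _ (fun y => C y (lift i k) (lift j l))) => [y|];
  first by rewrite !mxE.
by apply: expands_to_eq_near (EF _ _); apply: eq_nearW => e y; rewrite !mxE.
Qed.

Lemma expands_to_neq0 m (c : R -> R) f : (forall y, c y != 0) ->
  expands_to m c f ->
  near_loc (fun e y => f e y != 0).
Proof.
move=> c0 [Bc [g Ag fg]].
by have [] := nonvanish Bc c0 (bsmooth_bounded (expandable_bsmooth Ag)) fg.
Qed.

Lemma mx_expands_to_unit m n (C : R -> 'M[R]_n) F : mx_expands_to m C F ->
  (forall y, C y \in unitmx) -> near_loc (fun e y => F e y \in unitmx).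
Proof.
move=> EF uC; have := expands_to_neq0 _ (expands_to_det EF) => H.
apply: near_loc_mono (H _) => [e y|y]; first by rewrite unitmxE unitfE.
by have := uC y; rewrite unitmxE unitfE.
Qed.

(** By Cramer's rule each entry is a cofactor divided by the determinant, whose leading term does
    not vanish. *)
Lemma mx_expands_to_inv m n (C : R -> 'M[R]_n) F : mx_expands_to m C F ->
  (forall y, C y \in unitmx) ->
  mx_expands_to m (fun y => invmx (C y)) (fun e y => invmx (F e y)).
Proof.
move=> EF uC i j; have uF := mx_expands_to_unit EF uC.
apply: (@expands_to_ext _ _ (fun y => (\det (C y))^-1 * cofactor (C y) j i)) =>
  [y|].
  by rewrite /invmx uC !mxE.
apply: (@expands_to_eq_near _ _ _ (fun e y =>
  (\det (F e y))^-1 * cofactor (F e y) j i)).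
  by apply: near_loc_mono uF => e y uF; rewrite /invmx uF !mxE.
apply: expands_to_mul; last exact: expands_to_cofactor.
apply: expands_to_inv; last exact: expands_to_det.
by move=> y; have := uC y; rewrite unitmxE unitfE.
Qed.

Lemma vandermonde_kernel n (t : 'I_n -> R) (X : 'I_n -> R) : injective t ->
  (forall i, \sum_(a < n) t i ^+ a * X a = 0) -> forall a, X a = 0.
Proof.
move=> /vandermonde_unit; set V := (\matrix_(i, a) _) => uV VX a.
have : V *m \col_a X a = 0.
  apply/colP => i; rewrite !mxE -[RHS](VX i).
  by apply: eq_bigr => b _; rewrite !mxE.
move/(congr1 (mulmx (invmx V))); rewrite mulKmx // mulmx0 => /colP/(_ a).
by rewrite !mxE.
Qed.

End MatrixExpansions.

(** * The dual curve *)

Section DualCurve.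
Variables (R : realType) (d : nat) (G : 'I_d.+1 -> R -> R).
Hypothesis GB : forall j, bsmooth (fun _ => G j).

Definition coord_jet (y : R) : 'M[R]_d.+1 := \matrix_(k, j) derive1n k (G j) y.

Hypothesis uJ : forall y, coord_jet y \in unitmx.

(** The covector that pairs to 0 with [G, ..., G^(d-1)] and to 1 with [G^(d)], that is, a normal of
    the osculating hyperplane. *)
Definition dual_curve (l : 'I_d.+1) (y : R) : R := invmx (coord_jet y)
  l ord_max.

Lemma mx_expands_to_jet m : mx_expands_to m coord_jet (fun _ => coord_jet).
Proof.
move=> i j; apply: expands_to_lead.
apply: bsmooth_eq_near (bsmooth_derive1n i (GB j)); apply: eq_nearW => e y;
  by rewrite mxE.
Qed.

Lemma mx_expands_to_inv_jet m :
  mx_expands_to m (fun y => invmx (coord_jet y)) (fun _ y =>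
    invmx (coord_jet y)).
Proof. exact: mx_expands_to_inv (mx_expands_to_jet m) uJ. Qed.

Lemma dual_curve_bsmooth l : bsmooth (fun _ => dual_curve l).
Proof. exact: expands_to_lead_bsmooth (mx_expands_to_inv_jet 0 l ord_max). Qed.

(** Induction on [a]: when [j + a < d] the pairing of [G^(j)] with the [a]-th derivative of the dual
    curve is identically 0, and differentiating this identity trades a derivative of the dual curve
    for one of [G], with a change of sign. *)
Lemma dual_curve_pairing j a (y : R) : (j + a <= d)%N ->
  \sum_l derive1n j (G l) y * derive1n a (dual_curve l) y =
  if (j + a == d)%N then (-1) ^+ a else 0.
Proof.
elim: a j y => [|a IH] j y jad.
  rewrite addn0 in jad *; have jd : (j < d.+1)%N by [].
  have /matrixP/(_ (Ordinal jd) ord_max) := mulmxV (uJ y).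
  rewrite !mxE -val_eqE /= expr0 => H.
  have -> : (if j == d then 1 else 0) = (j == d)%:R :> R by case: (j == d).
  rewrite -H.
  by apply: eq_bigr => l _; rewrite mxE.
pose F z := \sum_l derive1n j (G l) z * derive1n a (dual_curve l) z.
have F0 : F = fun=> 0.
  apply/funext => z; rewrite /F IH; last by rewrite ltnW // -addnS.
  by rewrite ltn_eqF // -addnS.
have dF : is_derive y 1 F (\sum_l (derive1n j (G l)
  y * derive1n a.+1 (dual_curve l) y
    + derive1n a (dual_curve l) y * derive1n j.+1 (G l) y)).
  apply: is_derive_fsum => l; apply: is_deriveM; apply: derivable_is_derive.
    exact: bsmooth_derivable (bsmooth_derive1n j (GB l)).
  exact: bsmooth_derivable (bsmooth_derive1n a (dual_curve_bsmooth l)).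
have : derive1 F y = 0 by rewrite F0; exact: derive1_cst.
rewrite (is_derive_derive1 dF) big_split => /eqP; rewrite addr_eq0 => /eqP H.
apply: (etrans H); transitivity
  (- \sum_l derive1n j.+1 (G l) y * derive1n a (dual_curve l) y).
  by congr (- _); apply: eq_bigr => l _; rewrite mulrC.
rewrite IH; last by rewrite addSnnS.
by rewrite addSnnS; case: ifP; rewrite ?oppr0 // exprS mulN1r.
Qed.

(** Column 0 pairs to 1 with [G] and to 0 with its derivatives up to order [d]; it fixes the scale.
    The other columns are the derivatives of the dual curve in the order [d-1, ..., 0], which makes
    the product with the jet lower triangular. *)
Definition dual_frame (y : R) : 'M[R]_d.+1 := \matrix_(l, i)
  if unlift ord0 i is Some b then derive1n (rev_ord b) (dual_curve l) y
  else invmx (coord_jet y) l ord0.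

Lemma jet_dual_frame y : let X := coord_jet y *m dual_frame y in
  [/\ forall i j : 'I_d.+1, (i < j)%N ->
    X i j = 0, forall i, X i i != 0 & X 0 0 = 1].
Proof.
have A0 i : (coord_jet y *m dual_frame y) i ord0 = (i == ord0)%:R.
  have /matrixP/(_ i ord0) := mulmxV (uJ y); rewrite [RHS]mxE => <-.
  by rewrite !mxE; apply: eq_bigr => l _; congr (_ * _);
    rewrite mxE unlift_none.
have A1 (i : 'I_d.+1) (b : 'I_d) : (i <= b.+1)%N ->
   (coord_jet y *m dual_frame y) i (lift ord0 b) =
   if (i == b.+1 :> nat) then (-1) ^+ (rev_ord b) else 0.
  move=> ib; rewrite mxE.
  have -> : \sum_l coord_jet y i l * dual_frame y l (lift ord0 b) =
      \sum_l derive1n i (G l) y * derive1n (rev_ord b) (dual_curve l) y.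
    by apply: eq_bigr => l _; rewrite !mxE liftK.
  have bd : (b < d)%N by [].
  have ibE : (i + rev_ord b == d)%N = (i == b.+1 :> nat).
    by rewrite -[X in (_ == X)%N](subnK bd) /= addnC eqn_add2l.
  rewrite dual_curve_pairing ?ibE //=.
  by rewrite -[X in (_ <= X)%N](subnK bd) /= addnC leq_add2l.
split=> [i j|i|]; last by rewrite A0.
  case: (unliftP ord0 j) => [b ->|-> //] /= ib.
  by rewrite A1; [rewrite ltn_eqF|exact: ltnW].
case: (unliftP ord0 i) => [b ->|->]; last by rewrite A0 eqxx oner_neq0.
by rewrite A1 /= ?leqnn // eqxx signr_eq0.
Qed.

Lemma dual_frame_unit y : dual_frame y \in unitmx.
Proof.
have [tA dA _] := jet_dual_frame y.
have : \det (coord_jet y *m dual_frame y) != 0.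
  rewrite det_trig; last exact/is_trig_mxP.
  exact/prodf_neq0.
by rewrite det_mulmx mulf_eq0 negb_or unitmxE unitfE => /andP[].
Qed.

(** Biduality: [G] is annihilated by the derivatives of orders [0, ..., d-1] of its dual curve and
    pairs to 1 with column 0, so it is the first row of the inverse frame. *)
Lemma curve_from_dual_frame y l : invmx (dual_frame y) 0 l = G l y.
Proof.
have [tA _ A00] := jet_dual_frame y.
have : (\row_l G l y) *m dual_frame y = delta_mx 0 0.
  apply/rowP => j; rewrite !mxE eqxx /=.
  have -> : \sum_i (\row_l G l y) 0 i * dual_frame y i j =
            (coord_jet y *m dual_frame y) 0 j.
    by rewrite [RHS]mxE; apply: eq_bigr => i _; rewrite !mxE.
  case: (unliftP ord0 j) => [b ->|->]; last by rewrite A00.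
  by rewrite tA.
move/(congr1 (mulmx^~ (invmx (dual_frame y))));
  rewrite mulmxK ?dual_frame_unit //.
by rewrite -rowE => /rowP/(_ l); rewrite !mxE.
Qed.

End DualCurve.
(** * Intersection of the diagonal planes *)

Section ShortDiagonals.
Variables (R : realType) (d : nat) (G : 'I_d.+1 -> R -> R).
Hypothesis GB : forall j, bsmooth (fun _ => G j).
Hypothesis uJ : forall y, coord_jet G y \in unitmx.

(** Collocation writes the [d] points in terms of families [h_a], [a < d], with leading terms
    [G^(a)]. Adjoining [G^(d)] gives an invertible matrix near the jet, and the last column of its
    inverse annihilates every [h_a]. *)
Lemma span_normal (t : 'I_d -> R) m : injective t ->
  exists2 nu : 'I_d.+1 -> R -> R ->
    R, (forall l, expands_to m (dual_curve G l) (nu l)) &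
    near_loc (fun e y => forall a : 'I_d -> R,
      \sum_l (\sum_k a k * G l (y + t k * e)) * nu l e y = 0).
Proof.
move=> tI.
have /fin_all_exists2[h Eh Gh] : forall l, exists2 h : 'I_d -> R -> R -> R,
    (forall a : 'I_d, expands_to m (derive1n a (G l)) (h a)) &
    forall k, eq_near (fun e y => G l (y + t k * e))
      (fun e y => \sum_(a < d) t k ^+ a * (e ^+ a / a`!%:R * h a e y)).
  by move=> l; have [h Eh Gh] := collocation tI (expands_to_lead m (GB l));
    exists h.
pose H (e y : R) : 'M[R]_d.+1 := \matrix_(i, l)
  if unlift ord_max i is Some a then h l a e y else derive1n d (G l) y.
have EH : mx_expands_to m (coord_jet G) H.
  move=> i l; rewrite /coord_jet; case: (unliftP ord_max i) => [a ->|->].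
    apply: (@expands_to_ext _ _ (derive1n a (G l))) => [y|];
      first by rewrite mxE lift_max.
    by apply: expands_to_eq_near (Eh l a); apply: eq_nearW => e y;
      rewrite mxE liftK.
  apply: (@expands_to_ext _ _ (derive1n d (G l))) => [y|]; first by rewrite mxE.
  apply: expands_to_eq_near (expands_to_lead m (bsmooth_derive1n d (GB l))).
  by apply: eq_nearW => e y; rewrite mxE unlift_none.
exists (fun l e y => invmx (H e y) l ord_max); first by move=> l;
  exact: mx_expands_to_inv.
have Gh' : near_loc (fun e y => forall l k, G l (y + t k * e) =
    \sum_(a < d) t k ^+ a * (e ^+ a / a`!%:R * h l a e y)).
  by apply: near_loc_all => l; apply: near_loc_all => k; exact: Gh.
apply: near_loc_mono2 Gh' (mx_expands_to_unit EH uJ) => e y Ge uH a.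
(* Coordinates of the combination in the rows of [H]; the last one is 0 because [G^(d)] does not
   occur. *)
pose b : 'rV[R]_d.+1 := \row_i if unlift ord_max i is Some c then
  \sum_k a k * (t k ^+ c * (e ^+ c / c`!%:R)) else 0.
have bH l : (b *m H e y) 0 l = \sum_k a k * G l (y + t k * e).
  rewrite mxE (bigD1_ord ord_max) //= !mxE unlift_none mul0r add0r.
  under eq_bigr => c _ do rewrite !mxE liftK mulr_suml.
  rewrite exchange_big /=; apply: eq_bigr => k _; rewrite Ge mulr_sumr.
  by apply: eq_bigr => c _; rewrite -!mulrA.
under eq_bigr => l _ do rewrite -bH.
have := mulmxK uH b => /rowP/(_ ord_max); rewrite mxE => ->.
by rewrite mxE unlift_none.
Qed.

(** The dual argument. [g] is orthogonal to the normal taken at each [y + s i * e], hence, by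
    collocation in [s], to [d] families with the derivatives of the dual curve as leading terms.
    Together with column 0 of the inverse jet they form a matrix [K] near the dual frame, and [g] is
    a multiple of row 0 of its inverse. Nothing is asserted yet about the size of the multiplier. *)
Lemma meet_of_spans m (g : R -> R -> 'rV[R]_d.+1) (s t : 'I_d -> R) :
  injective s -> injective t ->
  near_loc (fun e y => forall i, exists a : 'I_d -> R,
    forall l, g e y 0 l = \sum_k a k * G l (y + s i * e + t k * e)) ->
  exists2 P : 'I_d.+1 -> R -> R -> R, (forall l, expands_to m (G l) (P l)) &
    near_loc (fun e y => forall l, g e y 0 l =
      (\sum_k g e y 0 k * invmx (coord_jet G y) k ord0) * P l e y).
Proof.
move=> sI tI Hg.
have [nu Enu Gnu] := span_normal m tI.
have /fin_all_exists2[h Eh nuh] : forall l, exists2 h : 'I_d -> R -> R -> R,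
    (forall a : 'I_d, expands_to m (derive1n a (dual_curve G l)) (h a)) &
    forall k, eq_near (fun e y => nu l e (y + s k * e))
      (fun e y => \sum_(a < d) s k ^+ a * (e ^+ a / a`!%:R * h a e y)).
  by move=> l; have [h Eh Gh] := collocation sI (Enu l); exists h.
have nuh' : near_loc (fun e y => forall l k, nu l e (y + s k * e) =
    \sum_(a < d) s k ^+ a * (e ^+ a / a`!%:R * h l a e y)).
  by apply: near_loc_all => l; apply: near_loc_all => k; exact: nuh.
have Gnu' : near_loc (fun e y => forall i, forall a : 'I_d -> R,
    \sum_l (\sum_k a k * G l (y + s i * e + t k * e)) * nu l e (y + s i * e)
      = 0).
  by apply: near_loc_all => i; exact: (near_loc_shift (s i) Gnu).
have gh : near_loc (fun e y => forall a, \sum_l g e y 0 l * h l a e y = 0).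
  have H1 := near_locI Hg (@near_loc_gt0 R); have H2 := near_locI nuh' Gnu'.
  apply: (near_loc_mono _ (near_locI H1 H2)) => e y [[ge e0] [he Ne]] {H1 H2}.
  have := @vandermonde_kernel R d s
    (fun a => e ^+ a / a`!%:R * \sum_l g e y 0 l * h l a e y) sI.
  have Hz i : \sum_(a < d) s i ^+ a * (e ^+ a / a`!%:R * \sum_l g e y 0 l * h l
    a e y) = 0.
    have [al gal] := ge i; rewrite -[RHS](Ne i al).
    under [RHS]eq_bigr => l _ do rewrite -gal he mulr_sumr.
    rewrite exchange_big /=; apply: eq_bigr => a _.
    rewrite !mulr_sumr; apply: eq_bigr => l _; ring.
  (* For [e > 0] the factor [e^a / a!] is nonzero and can be cancelled. *)
  move=> /(_ Hz) + a => /(_ a)/eqP; rewrite mulf_eq0 => /orP[|/eqP//].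
  by rewrite mulf_eq0 invr_eq0 expf_eq0 pnatr_eq0 gt_eqF // andbF gtn_eqF //
    fact_gt0.
pose K (e y : R) : 'M[R]_d.+1 := \matrix_(l, i)
  if unlift ord0 i is Some b then h l (rev_ord b) e y
  else invmx (coord_jet G y) l ord0.
have EK : mx_expands_to m (dual_frame G) K.
  move=> l i; case: (unliftP ord0 i) => [b ->|->].
    apply: (@expands_to_ext _ _ (derive1n (rev_ord b) (dual_curve G l))) =>
      [y|].
      by rewrite mxE liftK.
    by apply: expands_to_eq_near (Eh l _); apply: eq_nearW => e y;
      rewrite mxE liftK.
  apply: (@expands_to_ext _ _ (fun y => invmx (coord_jet G y) l ord0)) => [y|].
    by rewrite mxE unlift_none.
  apply: expands_to_eq_near (mx_expands_to_inv_jet GB uJ m l ord0).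
  by apply: eq_nearW => e y; rewrite mxE unlift_none.
have uK := mx_expands_to_unit EK (dual_frame_unit GB uJ).
exists (fun l e y => invmx (K e y) 0 l).
  move=> l; apply: (@expands_to_ext _ _ (fun y =>
    invmx (dual_frame G y) 0 l)) => [y|].
    exact: curve_from_dual_frame.
  exact: (mx_expands_to_inv EK (dual_frame_unit GB uJ)).
apply: near_loc_mono2 gh uK => e y gh uKe l.
set phi := \sum_k _.
have gK : g e y *m K e y = phi *: delta_mx 0 0.
  apply/rowP => i; rewrite [RHS]mxE [X in _ * X]mxE eqxx /= [LHS]mxE.
  case: (unliftP ord0 i) => [b ->|->].
    rewrite mulr0 -[RHS](gh (rev_ord b)); apply: eq_bigr => k _.
    by rewrite mxE liftK.
  rewrite mulr1; apply: eq_bigr => k _.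
  by rewrite mxE unlift_none.
have := mulmxK uKe (g e y); rewrite gK -scalemxAl -rowE => /rowP/(_ l) <-.
by rewrite !mxE.
Qed.

End ShortDiagonals.
(** * Normalization of the lift *)

Section Leibniz.
Variable R : realType.
Implicit Types (f p q : R -> R) (M y : R).

Lemma derive1n_mul n f p q M :
  (forall y, `|y| < M -> q y = f y * p y) ->
  (forall k, (k < n)%N -> forall y, `|y| < M ->
     derivable (derive1n k f) y 1 /\ derivable (derive1n k p) y 1) ->
  forall y, `|y| < M -> derive1n n q y =
    \sum_(i < n.+1) 'C(n, i)%:R * derive1n (n - i) f y * derive1n i p y.
Proof.
move=> qE; elim: n => [|n IH] Hd y yM.
  by rewrite big_ord_recl big_ord0 bin0 mul1r addr0 subn0; exact: qE.
have {}IH := IH (fun k kn => Hd k (leq_trans kn (leqnSn n))).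
have nM : \forall z \near y, `|z| < M.
  by have := @norm_continuous _ R y; move/cvgr_lt => /(_ M yM); exact.
have Hs : is_derive y 1 (fun z => \sum_(i < n.+1)
      'C(n, i)%:R * derive1n (n - i) f z * derive1n i p z)
    (\sum_(i < n.+1) ('C(n, i)%:R * derive1n (n - i).+1 f y * derive1n i p y +
       'C(n, i)%:R * derive1n (n - i) f y * derive1n i.+1 p y)).
  apply: is_derive_fsum => i.
  have [df _] := Hd (n - i)%N (leq_ltn_trans (leq_subr _ _) (ltnSn n)) y yM.
  have [_ dp] := Hd i (ltn_ord i) y yM.
  have H1 := is_deriveM (is_deriveZ 'C(n, i)%:R (derivable_is_derive df))
    (derivable_is_derive dp).
  apply: (is_derive_eq H1); rewrite /= /GRing.scale /=; ring.
rewrite /= [LHS](is_derive_derive1 (near_eq_is_derive _ Hs)); last first.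
  by move: nM; apply: filterS => z zM; rewrite IH.
rewrite big_split /=.
rewrite [X in X + _](_ : _ = \sum_(i < n.+2) 'C(n,
  i)%:R * derive1n (n.+1 - i) f y
    * derive1n i p y); last first.
  rewrite [RHS]big_ord_recr /= bin_small // !mul0r addr0.
  by apply: eq_bigr => i _; rewrite subSn // -ltnS.
rewrite [in RHS]big_ord_recl [X in X + _ = _]big_ord_recl /= !bin0 -addrA;
  congr (_ + _).
rewrite -big_split /=; apply: eq_bigr => i _.
by rewrite /bump /= add1n binS subSS natrD; ring.
Qed.

(** By Leibniz the jet of [f p] is the jet of [p] multiplied on the left by a lower triangular
    matrix with [f] on the diagonal. *)
Lemma det_jet_mul d (f : R -> R) (p q : 'I_d.+1 -> R -> R) M :
  (forall l y, `|y| < M -> q l y = f y * p l y) ->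
  (forall k, (k < d.+1)%N -> forall y, `|y| < M ->
    derivable (derive1n k f) y 1) ->
  (forall l k, (k < d.+1)%N -> forall y, `|y| < M ->
    derivable (derive1n k (p l)) y 1) ->
  forall y, `|y| < M -> \det (coord_jet q y)
    = f y ^+ d.+1 * \det (coord_jet p y).
Proof.
move=> qE df dp y yM.
pose L : 'M[R]_d.+1 := \matrix_(k, i) ('C(k, i)%:R * derive1n (k - i) f y).
have -> : coord_jet q y = L *m coord_jet p y.
  apply/matrixP => k l; rewrite !mxE.
  rewrite (@derive1n_mul k f (p l) (q l) M) //; last first.
  - move=> i ik z zM; have id : (i < d.+1)%N by exact: ltn_trans ik _.
    by split; [exact: df|exact: dp].
  - exact: qE.
  rewrite (big_ord_widen d.+1 (fun i =>
    'C(k, i)%:R * derive1n (k - i) f y * derive1n i (p l) y)) //.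
  rewrite big_mkcond /=; apply: eq_bigr => i _; rewrite !mxE.
  by case: ltnP => // ki; rewrite bin_small // !mul0r.
rewrite det_mulmx det_trig; last first.
  by apply/is_trig_mxP => i j ij; rewrite mxE bin_small // mul0r.
under eq_bigr do rewrite mxE binn subnn mul1r /=.
by rewrite prodr_const card_ord.
Qed.

(** With no dependence on [e], the bounds come from continuity on compact intervals. *)
Lemma derivable_bsmooth c : (forall n y, derivable (derive1n n c) y 1) ->
  bsmooth (fun _ => c).
Proof.
move=> dc k; elim: k c dc => [|k IH] c dc.
  split=> // M; have cc : continuous (fun y => `|c y|).
    move=> y; apply: cvg_norm.
    exact/differentiable_continuous/derivable1_diffP/(dc 0%N).
  have MM : - `|M| <= `|M| by rewrite ge0_cp.
  have [z zM Hz] := EVT_max MM (continuous_subspaceT cc).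
  exists `|c z|; apply: nearW => e y yM; apply: Hz.
  by rewrite in_itv /= -ler_norml ltW // (lt_le_trans yM) // ler_norm.
have dc' n y : derivable (derive1n n (derive1 c)) y 1 by rewrite -derive1Sn.
have Bc' := IH _ dc'; apply: (@bsmooth_upto_step _ _ _ (fun _ => derive1 c)) =>
  //.
  by have := IH _ dc => /bsmooth_upto_bounded.
by apply: near_locW => e y; apply: derivable_is_derive; exact: (dc 0%N).
Qed.

Lemma bsmooth_derivable1n c n y : bsmooth (fun _ => c) ->
  derivable (derive1n n c) y 1.
Proof. by move=> /(bsmooth_derive1n n)/bsmooth_derivable; exact. Qed.

Lemma continuous_pos f M : (forall y, derivable f y 1) ->
  (forall y, `|y| < M -> f y != 0) -> 0 < f 0 -> forall y, `|y| < M -> 0 < f y.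
Proof.
move=> df f0 f00 y yM; rewrite ltNge; apply/negP => fy.
have cf : continuous f by move=> z;
  exact/differentiable_continuous/derivable1_diffP.
have mm : Num.min (f (Num.min 0 y)) (f (Num.max 0 y))
  <= 0 <= Num.max (f (Num.min 0 y)) (f (Num.max 0 y)).
  case: (leP 0 y) => _; rewrite ge_min le_max ?fy ?(ltW f00) ?orbT //.
have [|z] := IVT _ (continuous_subspaceT cf) mm.
  by rewrite ge_min le_max lexx.
rewrite in_itv /= => /andP[z1 z2] fz.
have : `|z| < M.
  apply: le_lt_trans yM; rewrite ler_norml.
  move: z1 z2; case: (leP 0 y) => y0 z1 z2.
    by rewrite (ger0_norm y0) z2 andbT (le_trans _ z1) // oppr_le0.
  by rewrite (ltr0_norm y0) opprK z1 (le_trans z2) // oppr_ge0 ltW.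
by move/f0; rewrite fz eqxx.
Qed.

End Leibniz.

(** * Pointwise estimates and removal of the first-order term *)

Section PointwiseSecondOrder.
Variable R : realType.
Implicit Types (f g : R -> R -> R) (c : R -> R).

(** The constant and the threshold may depend on the point, as in the given expansion of the evolved
    lift. *)
Definition ptwise_O n f := forall y : R, exists C : R, \forall e \near 0^'+,
  `|f e y| <= C * e ^+ n.

Lemma bounded_ptwise_O f : bounded_near f -> ptwise_O 0 f.
Proof.
move=> bf y; have [C HC] := bf (`|y| + 1); exists C.
by move: HC; apply: filterS => e; rewrite expr0 mulr1; apply; rewrite ltrDl.
Qed.

Lemma ptwise_O_eq_near n f g : eq_near f g -> ptwise_O n f -> ptwise_O n g.
Proof.
move=> fg Of y; have [C HC] := Of y; exists C.
by move: (near_loc_pt y fg) HC; apply: filterS2 => e ->.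
Qed.

Lemma ptwise_O_add n f g : ptwise_O n f -> ptwise_O n g ->
  ptwise_O n (fun e y => f e y + g e y).
Proof.
move=> Of Og y; have [C HC] := Of y; have [D HD] := Og y; exists (C + D).
move: HC HD; apply: filterS2 => e HC HD; rewrite mulrDl.
by apply: le_trans (ler_normD _ _) _; exact: lerD.
Qed.

Lemma ptwise_O_mul n m f g : ptwise_O n f -> ptwise_O m g ->
  ptwise_O (n + m) (fun e y => f e y * g e y).
Proof.
move=> Of Og y; have [C HC] := Of y; have [D HD] := Og y; exists (C * D).
move: HC HD; apply: filterS2 => e HC HD.
by rewrite normrM exprD mulrACA ler_pM.
Qed.

Lemma ptwise_O_sum n (I : Type) (r : seq I) (F : I -> R -> R -> R) :
  (forall i, ptwise_O n (F i)) -> ptwise_O n (fun e y => \sum_(i <- r) F i e y).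
Proof.
move=> OF; elim: r => [|i r IH].
  move=> y; exists 0; apply: nearW => e; by rewrite big_nil normr0 mul0r.
apply: ptwise_O_eq_near (ptwise_O_add (OF i) IH); apply: eq_nearW => e y;
  by rewrite big_cons.
Qed.

Lemma near_le0 (C a : R) : (\forall e \near 0^'+, `|a| <= C * e) -> a = 0.
Proof.
move=> H; apply/eqP; rewrite -normr_le0 leNgt; apply/negP => a0.
have C1 : 0 < `|C| + 1 by rewrite ltr_wpDl.
have : 0 < `|a| / (`|C| + 1) by rewrite divr_gt0.
move=> /(@nbhs_right_lt R) H2.
have [e [[He e0] e2]] := near_ex (filterI (filterI H (@nbhs_right_gt R 0)) H2).
move: e2; rewrite ltr_pdivlMr //; apply/negP; rewrite -leNgt.
apply: le_trans He _; rewrite mulrC; apply: ler_wpM2l; first exact: ltW.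
by apply: le_trans (ler_norm C) _; rewrite lerDl.
Qed.

(** The expansion is [c + e c1 + e^2 r] with [r] controlled uniformly. An estimate at each point
    separately is enough to force [c1 = 0], and uniformity is inherited from [r]. *)
Lemma second_order c f : expands_to 1 c f ->
  ptwise_O 2 (fun e y => f e y - c y) ->
  exists2 r, bsmooth r & eq_near f (fun e y => c y + e ^+ 2 * r e y).
Proof.
move=> [Bc [g [c1 [r [Bc1 Br gE]]] fE]] Of; exists r => //.
have c10 y : c1 y = 0.
  have [C HC] := Of y; have [D HD] := bounded_ptwise_O (bsmooth_bounded Br) y.
  apply: (@near_le0 (C + D)).
  near=> e.
  have e0 : 0 < e by near: e; exact: nbhs_right_gt.
  have H1 : `|f e y - c y| <= C * e ^+ 2 by near: e; exact: HC.
  have H2 : `|r e y| <= D * e ^+ 0 by near: e; exact: HD.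
  have H3 : f e y = c y + e * g e y by near: e; exact: near_loc_pt fE.
  have H4 : g e y = c1 y + e * r e y by near: e; exact: near_loc_pt gE.
  move: H1; rewrite H3 H4 (_ : _ - _ = e * (c1 y + e * r e y)); last by ring.
  rewrite normrM (gtr0_norm e0) expr2 mulrCA ler_pM2l // => H1.
  rewrite expr0 mulr1 in H2.
  have -> : c1 y = (c1 y + e * r e y) - e * r e y by ring.
  rewrite mulrDl; apply: le_trans (ler_normB _ _) _; apply: lerD => //.
  by rewrite normrM (gtr0_norm e0) mulrC ler_pM2r.
by apply: near_loc_mono2 fE gE => e y -> ->; rewrite c10; ring.
Unshelve. all: end_near. Qed.

End PointwiseSecondOrder.

(** * The determinant condition and the amplitude of the lift *)

Section Normalization.
Variables (R : realType) (d : nat) (G : 'I_d.+1 -> R -> R).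
Hypothesis GB : forall j, bsmooth (fun _ => G j).
Hypothesis detJ : forall y, \det (coord_jet G y) = 1.

Lemma coord_jet_unitmx y : coord_jet G y \in unitmx.
Proof. by rewrite unitmxE detJ unitr1. Qed.

Lemma mx_expands_to_coord_jet m (P : 'I_d.+1 -> R -> R ->
  R) : (forall l, expands_to m (G l) (P l)) ->
  mx_expands_to m (coord_jet G) (fun e y => coord_jet (fun l => P l e) y).
Proof.
move=> EP k l; apply: (@expands_to_ext _ _ (derive1n k (G l))) => [y|];
  first by rewrite mxE.
by apply: expands_to_eq_near (expands_to_derive1n k (EP l));
  apply: eq_nearW => e y; rewrite mxE.
Qed.

(* The amplitude [phi] of a lift is determined up to sign by its Wronskian: its
   power of exponent n.+1 has an expansion, and so has [phi] itself. *)
Lemma amplitude_second_order n (phi q : R -> R -> R) :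
  near_loc (fun e y => derivable (phi e) y 1) ->
    near_loc (fun e y => 0 < phi e y) ->
  eq_near (fun e y => phi e y ^+ n.+1) q -> expands_to 1 (fun=> 1) q ->
  ptwise_O 2 (fun e y => phi e y - 1) ->
  exists2 a, bsmooth a & eq_near phi (fun e y => 1 + e ^+ 2 * a e y).
Proof.
move=> dphi phi0 phiq Eq Ophi.
have Bq := expands_to_bsmooth Eq.
have q0 : near_loc (fun e y => 0 < q e y).
  by apply: near_loc_mono2 phi0 phiq => e y p0 <-; rewrite exprn_gt0.
have bphi : bounded_near phi.
  (* A positive number [p] is at most [1 + p^(n+1)]. *)
  apply: (@bounded_near_le _ (fun e y => 1 + q e y)).
    have := near_locI phi0 phiq; apply: near_loc_mono => e y [p0 pq].
    rewrite -pq (gtr0_norm p0) ger0_norm;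
      last by rewrite addr_ge0 // exprn_ge0 // ltW.
    case: (leP (phi e y) 1) => p1.
      by apply: le_trans p1 _; rewrite lerDl exprn_ge0 // ltW.
    apply: (@le_trans _ _ (phi e y ^+ n.+1)); last by rewrite lerDr.
    by rewrite -[X in X <= _]expr1 ler_weXn2l // ltW.
  by apply: bounded_near_add; [exact: bounded_near_cst|exact: bsmooth_bounded].
have Eqi : expands_to 1 (fun=> (1 : R)^-1) (fun e y => (q e y)^-1).
  by apply: expands_to_inv => // y; rewrite oner_neq0.
(* The logarithmic derivative of [phi]: since [phi' = phi w], the bound on [phi] propagates to all
   its derivatives. *)
pose w (e y : R) := n.+1%:R^-1 * (derive1 (q e) y * (q e y)^-1).
have Bw : bsmooth w.
  by apply: bsmooth_scale; apply: bsmooth_mul;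
    [exact: bsmooth_derive1|exact: expands_to_bsmooth Eqi].
have dphi' : near_loc (fun e y => is_derive y 1 (phi e) (phi e y * w e y)).
  have := near_locI (near_locI dphi phi0)
    (near_locI phiq (eq_near_derive1 phiq)).
  apply: near_loc_mono => e y [[dp p0] [pq pq']].
  apply: (is_derive_eq (derivable_is_derive dp)).
  have := is_derive_derive1 (is_deriveX n.+1 (derivable_is_derive dp)).
  rewrite /w; have -> : phi e ^+ n.+1 = (fun z => phi e z ^+ n.+1).
    by apply/funext => z; rewrite exprfctE.
  rewrite -pq' => ->; rewrite -pq /GRing.scale /= exprS.
  have n0 : n.+1%:R != 0 :> R by rewrite pnatr_eq0.
  have pn : phi e y != 0 by rewrite gt_eqF.
  have pn' : phi e y ^+ n != 0 by rewrite expf_neq0.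
  by field; rewrite pn pn' addrC natr1 n0.
have Bphi : bsmooth phi.
  move=> k; elim: k => [|k IH]; first by split.
  by apply: (bsmooth_upto_step bphi dphi'); apply: bsmooth_upto_mul.
(* The geometric sum satisfies [phi^(n+1) - 1 = (phi - 1) S] and [S >= 1], so the second-order
   expansion of [q] can be divided by [S]. *)
pose S (e y : R) := \sum_(i < n.+1) phi e y ^+ i.
have BX i : bsmooth (fun e y => phi e y ^+ i).
  elim: i => [|i IH].
    by apply: bsmooth_eq_near (bsmooth_cst 1); apply: eq_nearW => e y;
      rewrite expr0.
  by apply: bsmooth_eq_near (bsmooth_mul Bphi IH); apply: eq_nearW => e y;
    rewrite exprS.
have BS : bsmooth S by apply: bsmooth_sum.
have S1 : near_loc (fun e y => 1 <= S e y).
  apply: near_loc_mono phi0 => e y p0; rewrite /S big_ord_recl expr0 lerDl.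
  by apply: sumr_ge0 => i _; rewrite exprn_ge0 // ltW.
have BSi : bsmooth (fun e y => (S e y)^-1).
  apply: bsmooth_inv => //; first by apply: near_loc_mono S1 => e y s1;
    rewrite gt_eqF // (lt_le_trans ltr01).
  apply: (@bounded_near_le _ (fun _ _ => 1)); last exact: bounded_near_cst.
  apply: near_loc_mono S1 => e y s1; have s0 := lt_le_trans ltr01 s1.
  by rewrite normr1 normfV gtr0_norm // invf_le1.
have phiS e y : phi e y ^+ n.+1 - 1 = (phi e y - 1) * S e y by rewrite subrX1.
have Oq : ptwise_O 2 (fun e y => q e y - 1).
  apply: (@ptwise_O_eq_near _ _ (fun e y => (phi e y - 1) * S e y)).
    by apply: near_loc_mono phiq => e y <-; rewrite phiS.
  rewrite -[2%N]addn0; apply: ptwise_O_mul => //;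
    exact/bounded_ptwise_O/bsmooth_bounded.
have [r Br qr] := second_order Eq Oq.
exists (fun e y => r e y * (S e y)^-1); first exact: bsmooth_mul.
have := near_locI phiq (near_locI qr S1);
  apply: near_loc_mono => e y [pq [qe s1]].
have s0 : S e y != 0 by rewrite gt_eqF // (lt_le_trans ltr01).
have -> : phi e y = 1 + (phi e y - 1) * S e y / S e y by rewrite mulfK //; ring.
by rewrite -phiS pq qe; field.
Qed.

(** Write [g = phi P]. The determinant condition reads [phi^(d+1) det(jet P) = 1], so [phi^(d+1)]
    has an expansion starting at 1 and [amplitude_second_order] applies to [phi]. Then [P] has no
    first-order term either, and the two expansions are multiplied. *)
Lemma normalized_second_order (g : R -> R -> 'rV[R]_d.+1) (P : 'I_d.+1 -> R ->
  R -> R) :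
  (\forall e \near 0^'+, forall l, bsmooth (fun _ y => g e y 0 l)) ->
  (\forall e \near 0^'+, forall y, \det (coord_jet (fun l z =>
    g e z 0 l) y) = 1) ->
  (forall l, ptwise_O 2 (fun e y => g e y 0 l - G l y)) ->
  (forall l, expands_to 1 (G l) (P l)) ->
  near_loc (fun e y => forall l, g e y 0 l =
      (\sum_k g e y 0 k * invmx (coord_jet G y) k ord0) * P l e y) ->
  exists2 h : 'I_d.+1 -> R -> R -> R, (forall l, bsmooth (h l)) &
    forall l, eq_near (fun e y => g e y 0 l) (fun e y =>
      G l y + e ^+ 2 * h l e y).
Proof.
move=> gB detg Og EP gP.
pose kap k y := invmx (coord_jet G y) k ord0.
have Bkap k : bsmooth (fun _ =>
  kap k) by exact: expands_to_lead_bsmooth (mx_expands_to_inv_jet GB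
  coord_jet_unitmx 0 k ord0).
pose phi (e y : R) := \sum_k g e y 0 k * kap k y.
have Gkap y : \sum_k G k y * kap k y = 1.
  have /matrixP/(_ 0 0) := mulmxV (coord_jet_unitmx y).
  by rewrite !mxE => H; rewrite -[RHS]H; apply: eq_bigr => k _; rewrite !mxE.
have Ophi : ptwise_O 2 (fun e y => phi e y - 1).
  apply: (@ptwise_O_eq_near _ _ (fun e y =>
    \sum_k (g e y 0 k - G k y) * kap k y)).
    apply: eq_nearW => e y; rewrite -(Gkap y) /phi -sumrB.
    by apply: eq_bigr => k _; rewrite mulrBl.
  apply: ptwise_O_sum => k; rewrite -[2%N]addn0; apply: ptwise_O_mul => //.
  exact/bounded_ptwise_O/bsmooth_bounded.
have phiB : \forall e \near 0^'+, bsmooth (fun _ => phi e).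
  move: gB; apply: filterS => e ge; apply: bsmooth_sum => k.
  by apply: bsmooth_mul.
pose delta (e y : R) := \det (coord_jet (fun l => P l e) y).
have Edelta : expands_to 1 (fun=> 1) delta.
  by apply: expands_to_ext (expands_to_det (mx_expands_to_coord_jet EP)) => y.
have phid : near_loc (fun e y => phi e y ^+ d.+1 * delta e y = 1).
  move=> M; have dP : near_loc (fun e y => forall l k, (k < d.+1)%N ->
      derivable (derive1n k (P l e)) y 1).
    by apply: near_loc_all => l; apply: bsmooth_derivable_upto;
      exact: expands_to_bsmooth (EP l).
  move: (phiB) (detg) {dP} (dP M) (gP M) => H1 H2 H3 H4.
  near=> e => y yM.
  have pB : bsmooth (fun _ => phi e) by near: e.
  have dg : forall y, \det (coord_jet (fun l z => g e z 0 l) y) = 1 by near: e.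
  rewrite -(dg y); symmetry; apply: (@det_jet_mul _ _ (phi e) _ _ M) => //.
  - by move=> l z zM; move: z zM l; near: e.
  - by move=> k kd z zM; exact: bsmooth_derivable1n.
  - by move=> l k kd z zM; move: z zM l k kd; near: e.
have phi1 y : \forall e \near 0^'+, 0 < phi e y.
  have [C HC] := Ophi y.
  have C1 : 0 < `|C| + 1 by rewrite ltr_wpDl.
  have C2 : 0 < (`|C| + 1)^-1 by rewrite invr_gt0.
  near=> e.
  have e0 : 0 < e by near: e; exact: nbhs_right_gt.
  have e1 : e <= 1 by near: e; exact: nbhs_right_le.
  have eC : e < (`|C| + 1)^-1 by near: e; exact: nbhs_right_lt.
  have H : `|phi e y - 1| <= C * e ^+ 2 by near: e; exact: HC.
  have H2 : C * e ^+ 2 < 1.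
    apply: (@le_lt_trans _ _ ((`|C| + 1) * e)).
      apply: (@le_trans _ _ (`|C| * e ^+ 2)).
        by apply: ler_wpM2r (ler_norm C); rewrite exprn_ge0 // ltW.
      apply: ler_pM => //; first by rewrite exprn_ge0 // ltW.
        by rewrite lerDl.
      by rewrite expr2 ler_piMl // ltW.
    by rewrite -ltr_pdivlMl // mulr1.
  have := le_lt_trans H H2; rewrite ltr_norml; lra.
(* By the determinant condition [phi] has no zero on the interval, so its sign at 0, where it is
   positive for small [e], is its sign throughout. *)
have phi0 : near_loc (fun e y => 0 < phi e y).
  move=> M; move: phiB (phi1 0) (phid M).
  apply: filterS3 => e pB p0 pd y yM; apply: (@continuous_pos _ _ M) => //.
    by move=> z; exact: bsmooth_derivable.
  move=> z /pd; case: eqP => // ->; rewrite expr0n /= mul0r => /eqP.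
  by rewrite eq_sym oner_eq0.
have dphi : near_loc (fun e y => derivable (phi e) y 1).
  by move=> M; move: phiB; apply: filterS => e pB y _; exact: bsmooth_derivable.
have phiq : eq_near (fun e y => phi e y ^+ d.+1) (fun e y => (delta e y)^-1).
  apply: near_loc_mono phid => e y pd; have d0 : delta e y != 0.
    by apply/eqP => d0; move: pd; rewrite d0 mulr0 => /eqP;
      rewrite eq_sym oner_eq0.
  by apply: (mulIf d0); rewrite pd mulVf.
have Eq : expands_to 1 (fun=> 1) (fun e y => (delta e y)^-1).
  apply: (@expands_to_ext _ _ (fun=> 1^-1)); first by move=> y; rewrite invr1.
  by apply: expands_to_inv => // y; rewrite oner_neq0.
have [a Ba phia] := amplitude_second_order dphi phi0 phiq Eq Ophi.
(* [P - G = (g - G) - (phi - 1) P] because [g = phi P]. *)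
have OP l : ptwise_O 2 (fun e y => P l e y - G l y).
  apply: (@ptwise_O_eq_near _ _ (fun e y =>
    (g e y 0 l - G l y) + (phi e y - 1) * (-1 * P l e y))).
    by apply: near_loc_mono gP => e y /(_ l); rewrite -/(phi e y) => ->; ring.
  apply: ptwise_O_add => //; rewrite -[2%N]addn0; apply: ptwise_O_mul => //.
  by apply/bounded_ptwise_O/bsmooth_bounded/bsmooth_scale/expands_to_bsmooth/EP.
have /fin_all_exists2[b Bb Pb] : forall l, exists2 b, bsmooth b &
    eq_near (P l) (fun e y => G l y + e ^+ 2 * b e y).
  by move=> l; exact: second_order (EP l) (OP l).
(* What multiplies [e^2] in the product [(1 + e^2 a) (G + e^2 b)]. *)
exists (fun l e y => a e y * G l y + b l e y + e * (e * (a e y * b l e y))).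
  move=> l; have BI : forall f, bsmooth f -> bsmooth (fun e y : R => e * f e y).
    by move=> f Bf; apply: bsmooth_mul => //; exact: bsmooth_id.
  apply: bsmooth_add; first by apply: bsmooth_add;
    [exact: bsmooth_mul|exact: Bb].
  by apply/BI/BI/bsmooth_mul.
move=> l; have := near_locI gP (near_locI phia (Pb l));
  apply: near_loc_mono => e y [ge [pe Pe]].
rewrite ge -/(phi e y) pe Pe; ring.
Unshelve. all: end_near. Qed.

End Normalization.
(** * Divided differences and limits *)

Section FiniteDifferences.
Variable R : realType.
Implicit Types (f g : R -> R -> R) (c h : R -> R) (e y : R).

Definition fdiff e h y := (h (y + e) - h y) / e.

Definition fdiffn n f e y := iter n (fdiff e) (f e) y.

Lemma fdiffnS n f e y : fdiffn n.+1 f e y = (fdiffn n f e (y + e)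
  - fdiffn n f e y) / e.
Proof. by []. Qed.

Lemma fdiffn_add n f g a e y :
  fdiffn n (fun e y => f e y + a e * g e y)
    e y = fdiffn n f e y + a e * fdiffn n g e y.
Proof. by elim: n y => [//|n IH] y; rewrite !fdiffnS !IH; ring. Qed.

Lemma fdiffn_eq_near n f g : eq_near f g -> eq_near (fdiffn n f) (fdiffn n g).
Proof.
move=> fg; elim: n => [//|n IH].
apply: near_loc_mono2 IH (near_loc_shift 1 IH) => e y; rewrite mul1r => H1 H2.
by rewrite !fdiffnS H1 H2.
Qed.

(** Induction on [n]: one more divided difference turns [f^(n)] into [f^(n+1)] up to a Taylor
    remainder of size [e], and maps [e r] to [e] times a bounded quotient. *)
Lemma fdiffn_expand n f : bsmooth f ->
  exists2 r, bsmooth r & eq_near (fdiffn n f) (fun e y =>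
    derive1n n (f e) y + e * r e y).
Proof.
move=> Bf; elim: n => [|n [r Br fr]].
  exists (fun _ _ => 0); first exact: bsmooth_cst.
  by apply: eq_nearW => e y; rewrite mulr0 addr0.
have fdT g : eq_near (fun e y => (g e (y + e) - g e y) / e) (taylor_quot 1 1 g).
  apply: eq_nearW => e y; rewrite /taylor_quot /taylor_rem big_ord_recl
    big_ord0.
  by rewrite !expr0 divr1 addr0 !mul1r expr1.
exists (fun e y => taylor_quot 2 1 (fun e =>
  derive1n n (f e)) e y + taylor_quot 1 1 r e y).
  by apply: bsmooth_add; apply: taylor_quot_bsmooth => //;
    exact: bsmooth_derive1n.
apply: (@eq_near_trans _ (fun e y => taylor_quot 1 1 (fun e =>
  derive1n n (f e)) e y + e * taylor_quot 1 1 r e y)).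
  apply: near_loc_mono2 (near_locI fr (near_loc_shift 1 fr))
    (near_locI (fdT (fun e => derive1n n (f e))) (fdT r)).
  move=> e y [fr0]; rewrite mul1r => fr1 [<- <-].
  by rewrite fdiffnS fr0 fr1; ring.
apply: near_loc_mono (taylor_quot_step 1 1 (fun e => derive1n n (f e))) =>
  e y ->.
by rewrite expr1 divr1 mul1r /=; ring.
Qed.

Lemma expands_to_fdn n c f : expands_to 0 c f ->
  expands_to 0 (derive1n n c) (fdiffn n f).
Proof.
move=> Ef; have [r Br fr] := fdiffn_expand n (expands_to_bsmooth Ef).
apply: expands_to_eq_near (eq_near_sym fr) _.
apply: (@expands_to_ext _ _ (fun y => derive1n n c y + 0)) => [y|];
  first by rewrite addr0.
by apply: expands_to_add; [exact: expands_to_derive1n|exact: expands_to_id].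
Qed.

(** The coefficients are the entries of [Dmx]; the induction step is Pascal's rule. *)
Lemma fdiffn_bin n h e y : e != 0 -> iter n (fdiff e) h y =
  \sum_(i < n.+1) (-1) ^+ (n - i) * 'C(n, i)%:R / e ^+ n * h (y + i%:R * e).
Proof.
move=> e0; elim: n y => [|n IH] y.
  by rewrite big_ord_recl big_ord0 /= mul0r !addr0 bin0 subnn !expr0 invr1
    !mulr1 mul1r.
rewrite /= {1}/fdiff !IH.
pose a i := (-1) ^+ (n - i) * 'C(n, i)%:R / e ^+ n : R.
rewrite (eq_bigr (fun i : 'I_n.+1 => a i * h (y + i.+1%:R * e))); last first.
  by move=> i _; congr (_ * h _); rewrite -natr1; ring.
rewrite [X in _ - X](_ : _ = \sum_(i < n.+2) a i * h (y + i%:R * e));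
  last first.
  by rewrite [RHS]big_ord_recr /= /a bin_small // mulr0 !mul0r addr0.
rewrite [RHS]big_ord_recl [X in _ - X]big_ord_recl /= mul0r addr0 opprD addrCA
  mulrDl.
have en : e ^+ n != 0 by rewrite expf_neq0.
congr (_ + _).
  by rewrite /a !subn0 !bin0 !exprS; field; rewrite en e0.
rewrite -sumrB mulr_suml; apply: eq_bigr => i _.
rewrite /bump /= add1n -mulrBl mulrAC; congr (_ * _);
  rewrite /a binS subSS natrD exprS.
(* At [i = n] the exponent [n - i.+1] is truncated to 0, but the binomial coefficient beside it
   vanishes. *)
have [ni|ni] := leqP n i.
  have -> : nat_of_ord i = n by apply/eqP; rewrite eqn_leq ni -ltnS ltn_ord.
  by rewrite (bin_small (ltnSn n)); field; rewrite en e0.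
by rewrite subnS -[in (-1) ^+ (n - i)](prednK (n := n - i)) ?subn_gt0 // exprS;
  field; rewrite en e0.
Qed.

Lemma expands_to_cvg m c f y : expands_to m c f -> f e y @[e --> 0^'+] --> c y.
Proof.
move=> [_ [g Ag fg]]; have [C HC]
  := bounded_ptwise_O (bsmooth_bounded (expandable_bsmooth Ag)) y.
apply/cvgrPdist_le => eps eps0; near=> e.
have e0 : 0 < e by near: e; exact: nbhs_right_gt.
have H1 : f e y = c y + e * g e y by near: e; exact: near_loc_pt fg.
have H2 : `|g e y| <= C * e ^+ 0 by near: e; exact: HC.
rewrite expr0 mulr1 in H2.
have C1 : 0 < `|C| + 1 by rewrite ltr_wpDl.
have H3 : e <= eps / (`|C| + 1).
  by near: e; apply: nbhs_right_le; rewrite divr_gt0.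
rewrite H1 opprD addrA subrr sub0r normrN normrM (gtr0_norm e0).
move: H3; rewrite ler_pdivlMr //; apply: le_trans; apply: ler_wpM2l;
  first exact: ltW.
by rewrite (le_trans H2) // (le_trans (ler_norm C)) // lerDl.
Unshelve. all: end_near. Qed.

Lemma near_cvg (V : topologicalType) (p q : R -> V) (l : V) :
  (\forall e \near 0^'+, p e = q e) ->
  q e @[e --> 0^'+] --> l -> p e @[e --> 0^'+] --> l.
Proof.
move=> pq; apply: cvg_trans; apply: near_eq_cvg.
by move: pq; apply: filterS => e ->.
Qed.

(** Interpolation: a bound on the second derivative turns pointwise convergence of the values into
    convergence of the first derivative, through a Taylor formula with a step [s] independent of
    [e]. *)
Lemma cvg0_derive1 f : bsmooth f -> (forall y, f e y @[e --> 0^'+] --> 0) ->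
  forall y, derive1 (f e) y @[e --> 0^'+] --> 0.
Proof.
move=> Bf f0 y; apply/cvgr0Pnorm_le => eps eps0.
pose M := `|y| + 2.
have [C HC] := bsmooth_bounded (bsmooth_derive1n 2 Bf) M.
have C1 : 0 < `|C| + 1 by rewrite ltr_wpDl.
(* The step is chosen first, so that the Taylor remainder is at most [eps / 2 * s]; then [e] is
   taken so small that the two values are at most [eps / 4 * s] each. *)
pose s := Num.min 1 (eps / 2 / (`|C| + 1)).
have s0 : 0 < s by rewrite lt_min ltr01 !divr_gt0.
have s1 : s <= 1 by rewrite ge_min lexx.
have sC : s * (`|C| + 1) <= eps / 2 by rewrite -ler_pdivlMr // ge_min lexx orbT.
have k0 : 0 < eps / 4 * s by rewrite mulr_gt0 // divr_gt0.
have /cvgr0Pnorm_le/(_ _ k0) N1 := f0 y.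
have /cvgr0Pnorm_le/(_ _ k0) N2 := f0 (y + s).
near=> e.
have H1 : `|f e y| <= eps / 4 * s by near: e.
have H2 : `|f e (y + s)| <= eps / 4 * s by near: e.
have yM : `|y| < M by rewrite /M ltrDl.
have ysM : `|y + s| < M.
  apply: le_lt_trans (ler_normD _ _) _; rewrite (gtr0_norm s0) /M ltrD2l.
  by rewrite (le_lt_trans s1) // ltr1n.
have H3 : `|taylor_rem 2 (f e) y s| <= `|C| * `|s| ^+ 2.
  apply: (@taylor_rem_bound _ 2 (f e) M) => //.
    by move=> k kn z zM; move: z zM k kn; near: e;
      exact: bsmooth_derivable_upto.
  by move=> z zM; apply: le_trans (ler_norm C); move: z zM; near: e; exact: HC.
have E1 : derive1 (f e) y * s = f e (y + s) - f e y - taylor_rem 2 (f e) y s.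
  rewrite /taylor_rem !big_ord_recl big_ord0 /= expr0 expr1 !divr1; ring.
rewrite -(ler_pM2r s0) -{1}(gtr0_norm s0) -normrM E1.
apply: le_trans (ler_normB _ _) _.
have -> : eps * s = (eps / 4 * s + eps / 4 * s) + eps / 2 * s by field.
apply: lerD.
  by apply: le_trans (ler_normB _ _) _; apply: lerD.
apply: le_trans H3 _; rewrite (gtr0_norm s0) expr2 mulrA ler_pM2r //.
by apply: le_trans sC; rewrite mulrC ler_pM2l // lerDl.
Unshelve. all: end_near. Qed.

Lemma cvg_derive1 f c : bsmooth f -> bsmooth (fun _ => c) ->
  (forall y, f e y @[e --> 0^'+] --> c y) ->
  forall y, derive1 (f e) y @[e --> 0^'+] --> derive1 c y.
Proof.
move=> Bf Bc fc y; apply/subr_cvg0.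
have Bg : bsmooth (fun e y => f e y + -1 * c y) by apply: bsmooth_add => //;
  exact: bsmooth_scale.
have g0 z : f e z + -1 * c z @[e --> 0^'+] --> 0.
  suff : forall l, l = c z + -1 * c z -> f e z + -1 * c z @[e --> 0^'+] --> l.
    by apply; ring.
  by move=> l ->; apply: cvgD => //; exact: cvg_cst.
have := cvg0_derive1 Bg g0 y; apply: cvg_trans; apply: near_eq_cvg.
have := near_loc_pt y (near_locI (bsmooth_is_derive Bf) (bsmooth_is_derive Bc)).
apply: filterS => e [df dc].
have -> : (fun y => f e y + -1 * c y) = f e - c.
  by apply/funext => z; rewrite mulN1r.
by rewrite (is_derive_derive1 (is_deriveB df dc)).
Qed.

Lemma cvg_derive1n n f c : bsmooth f -> bsmooth (fun _ => c) ->
  (forall y, f e y @[e --> 0^'+] --> c y) ->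
  forall y, derive1n n (f e) y @[e --> 0^'+] --> derive1n n c y.
Proof.
move=> Bf Bc fc; elim: n => [//|n IH] y.
apply: (@cvg_derive1 (fun e => derive1n n (f e))) => //.
  exact: bsmooth_derive1n.
exact: (bsmooth_derive1n n Bc).
Qed.

Lemma cvg_fdiffn n f c y : bsmooth f -> bsmooth (fun _ => c) ->
  (forall z, f e z @[e --> 0^'+] --> c z) ->
  fdiffn n f e y @[e --> 0^'+] --> derive1n n c y.
Proof.
move=> Bf Bc fc; have [r Br fr] := fdiffn_expand n Bf.
have H := @cvg_derive1n n f c Bf Bc fc y.
have H2 := @expands_to_cvg 0 _ _ y (@expands_to_id _ 0 _ Br).
have H3 := cvgD H H2; rewrite /= addr0 in H3.
by apply: near_cvg (H3 _); exact: near_loc_pt fr.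
Qed.

End FiniteDifferences.
(** * The discrete Lax matrices *)

Section VectorCurves.
Variable R : realType.

Lemma derive1_mx m n (F : R -> 'M[R]_(m, n)) (y : R) i j : derivable F y 1 ->
  derive1 F y i j = derive1 (fun z => F z i j) y.
Proof. by move=> dF; rewrite !derive1E derive_mx // mxE. Qed.

Variable d : nat.
Implicit Types (G : R -> 'rV[R]_d.+1) (e x y : R).

Definition coordf G l z := G z 0 l.

Lemma derive1n_coord G k y l : smooth G ->
  derive1n k G y 0 l = derive1n k (coordf G l) y.
Proof.
move=> sG; elim: k y => [//|k IH] y /=.
rewrite derive1_mx; last exact: sG.
by congr (derive1 _ y); apply/funext => z; exact: IH.
Qed.

Lemma smooth_coord G l : smooth G -> bsmooth (fun _ => coordf G l).
Proof.
move=> sG; apply: derivable_bsmooth => n y.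
have -> : derive1n n (coordf G l) = fun z => derive1n n G z 0 l.
  by apply/funext => z; rewrite derive1n_coord.
by have := sG n y; move/derivable_mxP; apply.
Qed.

Lemma coord_smooth G : (forall l, bsmooth (fun _ => coordf G l)) -> smooth G.
Proof.
move=> GB; have H n : derive1n n G = fun y => \row_l derive1n n (coordf G l) y.
  elim: n => [|n IH] /=; apply/funext => y.
    by apply/rowP => l; rewrite mxE.
  have dn : derivable (derive1n n G) y 1.
    apply/derivable_mxP => i l; rewrite IH.
    have -> : (fun z => (\row_l derive1n n (coordf G l) z) i l)
      = derive1n n (coordf G l).
      by apply/funext => z; rewrite mxE.
    exact: bsmooth_derivable1n.
  apply/rowP => l; rewrite derive1_mx // mxE IH; congr (derive1 _ y).
  by apply/funext => z; rewrite mxE.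
move=> n y; apply/derivable_mxP => i l; rewrite H.
have -> : (fun z => (\row_l derive1n n (coordf G l) z) i l)
  = derive1n n (coordf G l).
  by apply/funext => z; rewrite mxE.
exact: bsmooth_derivable1n.
Qed.

Lemma jet_coord G y : smooth G -> jet G y = coord_jet (coordf G) y.
Proof.
by move=> sG; apply/matrixP => k l; rewrite !mxE derive1n_coord.
Qed.

End VectorCurves.

(** * Lax matrices as shifts of samples and of divided differences *)

Section DiscreteLax.
Variables (R : realType) (d : nat).
Implicit Types (G : R -> 'rV[R]_d.+1) (e x y : R).

Lemma companion_mul (a : 'rV[R]_d.+1) (X : 'M[R]_d.+1) i j :
  (companion a *m X) i j =
  if i == ord_max then (a *m X) 0 j else X (inord i.+1) j.
Proof.
rewrite !mxE; case: eqP => [->|/eqP im].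
  by apply: eq_bigr => k _; rewrite mxE eqxx.
have id : (i.+1 < d.+1)%N.
  by rewrite ltn_neqAle ltn_ord andbT eqSS -(inj_eq val_inj) in im *.
rewrite (bigD1 (inord i.+1)) //= big1 ?addr0 => [|k ki].
  by rewrite mxE (negbTE im) inordK // eqxx mul1r.
rewrite mxE (negbTE im); case: eqP => [kE|_]; last by rewrite mul0r.
by move: ki; rewrite -kE inord_val eqxx.
Qed.

Lemma lax_L_samples G e x i : let y := x + i%:R * e in
  samples G e y \in unitmx ->
    lax_L G e x i *m samples G e y = samples G e (y + e).
Proof.
move=> y uS; apply/matrixP => k l; rewrite companion_mul mulmxKV //.
rewrite !mxE; case: eqP => [->|/eqP km]; congr (G _ 0 l).
  by rewrite -/y /= -natr1; ring.
rewrite inordK; last by rewrite ltn_neqAle ltn_ord andbT eqSS -(inj_eq val_inj)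
  in km *.
by rewrite -natr1; ring.
Qed.

Lemma Dmx_unit e : e != 0 -> Dmx d e \in unitmx.
Proof.
move=> e0; rewrite unitmxE unitfE det_trig; last first.
  by apply/is_trig_mxP => i j ij; rewrite mxE bin_small // mulr0 mul0r.
apply/prodf_neq0 => i _; rewrite mxE subnn binn mul1r mul1r.
by rewrite invr_eq0 expf_neq0.
Qed.

Definition differences G e y : 'M[R]_d.+1 :=
  \matrix_(k, l) iter k (fdiff e) (coordf G l) y.

Definition next_differences G e y : 'M[R]_d.+1 :=
  \matrix_(k, l) iter k.+1 (fdiff e) (coordf G l) y.

Lemma Dmx_samples G e y : e != 0 ->
  Dmx d e *m samples G e y = differences G e y.
Proof.
move=> e0; apply/matrixP => k l; rewrite !mxE fdiffn_bin //.
rewrite (big_ord_widen d.+1 (fun i => (-1) ^+ (k - i) * 'C(k, i)%:R / e ^+ k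
   * coordf G l (y + i%:R * e))) // [RHS]big_mkcond /=.
apply: eq_bigr => i _; rewrite !mxE; case: ltnP => // ki.
by rewrite bin_small // mulr0 !mul0r.
Qed.

Lemma differences_step G e y : e != 0 ->
  differences G e (y + e) = differences G e y + e *: next_differences G e y.
Proof.
move=> e0; apply/matrixP => k l; rewrite !mxE /= /fdiff mulrC divfK //.
by rewrite addrC subrK.
Qed.

Lemma samples_unit G e y : differences G e y \in unitmx -> e != 0 ->
  samples G e y \in unitmx.
Proof. by move=> + e0; rewrite -Dmx_samples // unitmx_mul => /andP[]. Qed.

Lemma conjD_mul e (X Y : 'M[R]_d.+1) : e != 0 ->
  conjD e (X *m Y) = conjD e X *m conjD e Y.
Proof. by move=> e0; rewrite /conjD !mulmxA mulmxKV // Dmx_unit. Qed.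

Lemma conjD_inv e (X : 'M[R]_d.+1) : e != 0 -> X \in unitmx ->
  conjD e (invmx X) = invmx (conjD e X).
Proof.
move=> e0 uX; have uD := Dmx_unit e0.
have uC : conjD e X \in unitmx by rewrite /conjD !unitmx_mul uD uX unitmx_inv.
apply: (can_inj (mulKmx uC)); rewrite mulmxV // -conjD_mul // mulmxV //.
by rewrite /conjD mulmx1 mulmxV.
Qed.

(** Conjugated by [Dmx], the Lax matrix sends the divided differences [S] at [x] to those at
    [x + e], which are [S + e S']. *)
Lemma conjD_lax_L G e x : e != 0 -> differences G e x \in unitmx ->
  conjD e (lax_L G e x 0) =
  1%:M + e *: (next_differences G e x *m invmx (differences G e x)).
Proof.
move=> e0 uS; apply: (can_inj (mulmxK uS)).
rewrite mulmxDl mul1mx -scalemxAl mulmxKV // -differences_step // -!Dmx_samples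
  //.
rewrite /conjD !mulmxA mulmxKV ?Dmx_unit // -mulmxA.
have := @lax_L_samples G e x 0; rewrite /= mul0r addr0 => -> //.
exact: samples_unit.
Qed.

(** Both sides send the samples of [G'] at [x], which form an invertible matrix, to those at
    [x + e]. *)
Lemma lax_equation G G' e x : samples G e x \in unitmx ->
  samples G e (x + e) \in unitmx -> samples G' e x \in unitmx ->
  lax_L G' e x 0 = lax_P G G' e x 1 *m lax_L G e x 0 *m invmx (lax_P G G' e x
    0).
Proof.
move=> u1 u2 u3.
have L1 := @lax_L_samples G e x 0; have L2 := @lax_L_samples G' e x 0.
move: L1 L2; rewrite /lax_P /sending_mx /= mul0r addr0 mul1r =>
  /(_ u1) L1 /(_ u3) L2.
have uP : samples G' e x *m invmx (samples G e x) \in unitmx.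
  by rewrite unitmx_mul u3 unitmx_inv.
apply: (can_inj (mulmxK uP)); rewrite [RHS]mulmxKV //.
rewrite mulmxA L2; apply: (can_inj (mulmxK u1)); rewrite mulmxKV //.
by rewrite -[RHS]mulmxA L1 mulmxKV.
Qed.

Lemma mx_expands_to_differences (g : R -> R -> 'rV[R]_d.+1) (c : 'I_d.+1 ->
  R -> R) :
  (forall l, expands_to 0 (c l) (fun e => coordf (g e) l)) ->
  mx_expands_to 0 (coord_jet c) (fun e y => differences (g e) e y).
Proof.
move=> Eg k l; apply: (@expands_to_ext _ _ (derive1n k (c l))) => [y|];
  first by rewrite mxE.
by apply: expands_to_eq_near (expands_to_fdn k (Eg l)); apply: eq_nearW => e y;
  rewrite mxE.
Qed.

Lemma mx_expands_to_next_differences (g : R -> R ->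
  'rV[R]_d.+1) (c : 'I_d.+1 -> R -> R) :
  (forall l, expands_to 0 (c l) (fun e => coordf (g e) l)) ->
  mx_expands_to 0 (coord_jet (fun l => derive1 (c l))) (fun e y =>
    next_differences (g e) e y).
Proof.
move=> Eg k l; apply: (@expands_to_ext _ _ (derive1n k.+1 (c l))) => [y|].
  by rewrite mxE -derive1Sn.
by apply: expands_to_eq_near (expands_to_fdn k.+1 (Eg l));
  apply: eq_nearW => e y; rewrite mxE.
Qed.

End DiscreteLax.

(** * Explicit nodes of the short diagonals *)

Lemma diag_plane_span (R : realType) (d : nat) (gamma : R -> RP R d)
    (G : R -> 'rV[R]_d.+1) (e y : R) i v :
  (forall z, line_of (gamma z) = <[G z]>%VS) ->
  v \in diag_plane gamma e y i ->
  exists a : 'I_d -> R,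
    v = \sum_j a j *: G (y + (i - d.-1%:Z + 2 * j%:Z)%:~R * e).
Proof.
move=> line_G /memv_sumP[vs Hvs ->].
have /fin_all_exists[a Ha] : forall j : 'I_d, exists a : R,
    vs j = a *: G (y + (i - d.-1%:Z + 2 * j%:Z)%:~R * e).
  by move=> j; have := Hvs j isT; rewrite line_G => /vlineP[a ->]; exists a.
by exists a; apply: eq_bigr => j _; rewrite Ha.
Qed.

(** After centering, the plane with index [m] sits at [m - (d-1)/2] steps from [y] for both
    parities: for even [d] the shift by [e/2] makes up for the rounding in [(d.-1)./2]. *)
Lemma short_diag_centered_span (R : realType) (d : nat) (gamma : R -> RP R d)
    (G : R -> 'rV[R]_d.+1) (e y : R) v :
  (forall z, line_of (gamma z) = <[G z]>%VS) ->
  v \in short_diag_centered gamma e y ->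
  forall m : 'I_d, exists a : 'I_d -> R, forall l, v 0 l =
    \sum_j a j * coordf G l (y + (m%:R - d.-1%:R / 2)
      * e + (2 * j%:R - d.-1%:R) * e).
Proof.
case: d gamma G v => [|n] ga Ga v lG Hv m; first by case: m.
have Hm : v \in diag_plane ga e (if odd n.+1 then y else y - e / 2)
    (m%:Z - (n.+1.-1)./2%:Z).
  by move: Hv; rewrite memvE => /subv_bigcapP/(_ m isT); rewrite -memvE.
have [a ->] := diag_plane_span lG Hm; exists a => l.
rewrite summxE; apply: eq_bigr => j _; rewrite mxE; congr (_ * Ga _ 0 l).
rewrite /= !(intrD, intrB, intrM, rmorphD, rmorphB, rmorphM,
  rmorphN) /= -!pmulrn.
have -> : n%:R = (odd n)%:R + 2 * (n./2)%:R :> R.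
  by rewrite -[in LHS](odd_double_half n) natrD -muln2 natrM mulrC.
by case: (odd n) => /=; field.
Qed.

(** * Entrywise limits and Landau estimates *)

Section MatrixLimits.
Variable R : realType.

Lemma cvg_sumr (I : Type) (r : seq I) (F : I -> R -> R) (L : I -> R) :
  (forall i, F i e @[e --> 0^'+] --> L i) ->
  \sum_(i <- r) F i e @[e --> 0^'+] --> \sum_(i <- r) L i.
Proof.
move=> FL; elim: r => [|i r IH].
  rewrite big_nil; apply: (@near_cvg _ _ _ (fun _ => 0)); last exact: cvg_cst.
  by apply: nearW => e; rewrite big_nil.
rewrite big_cons; apply: (@near_cvg _ _ _ (fun e =>
  F i e + \sum_(j <- r) F j e)).
  by apply: nearW => e; rewrite big_cons.
by apply: cvgD.
Qed.

Definition mx_lim m n (F : R -> 'M[R]_(m, n)) (L : 'M[R]_(m, n)) :=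
  forall i j, F e i j @[e --> 0^'+] --> L i j.

Lemma mx_lim_cvg m n (F : R -> 'M[R]_(m, n)) L :
  mx_lim F L -> F e @[e --> 0^'+] --> L.
Proof.
move=> FL; apply/cvgrPdist_le => eps eps0; near=> e.
rewrite [leLHS]/Num.Def.normr /= mx_normrE (bigmax_le _ (ltW eps0)) //= => ij _.
rewrite !mxE /=; move: ij; near: e; apply: filter_forall => ij.
by have /cvgrPdist_le := FL ij.1 ij.2; exact.
Unshelve. all: end_near. Qed.

Lemma mx_lim_near m n (F F' : R -> 'M[R]_(m, n)) L :
  (\forall e \near 0^'+, F e = F' e) -> mx_lim F' L -> mx_lim F L.
Proof.
move=> FF' F'L i j; apply: near_cvg (F'L i j).
by move: FF'; apply: filterS => e ->.
Qed.

Lemma mx_lim_mul m n p (F : R -> 'M[R]_(m, n)) (F' : R -> 'M[R]_(n, p)) L L' :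
  mx_lim F L -> mx_lim F' L' -> mx_lim (fun e => F e *m F' e) (L *m L').
Proof.
move=> FL F'L i j; rewrite mxE.
apply: (@near_cvg _ _ _ (fun e => \sum_k F e i k * F' e k j)).
  by apply: nearW => e; rewrite mxE.
by apply: cvg_sumr => k; apply: cvgM; [exact: FL|exact: F'L].
Qed.

Lemma mx_lim_sub m n (F F' : R -> 'M[R]_(m, n)) L L' :
  mx_lim F L -> mx_lim F' L' -> mx_lim (fun e => F e - F' e) (L - L').
Proof.
move=> FL F'L i j; rewrite 2!mxE.
apply: (@near_cvg _ _ _ (fun e => F e i j - F' e i j)).
  by apply: nearW => e; rewrite !mxE.
by apply: cvgB; [exact: FL|exact: F'L].
Qed.

Lemma mx_expands_to_lim m p q (C : R -> 'M[R]_(p, q)) F y :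
  mx_expands_to m C F -> mx_lim (fun e => F e y) (C y).
Proof. by move=> EF i j; exact: (@expands_to_cvg _ m _ _ y (EF i j)). Qed.

Lemma mx_eqO m n (F : R -> 'M[R]_(m, n)) k :
  (forall i j, exists C, \forall e \near 0^'+, `|F e i j| <= C * e ^+ k) ->
  F =O_ (0^'+) (fun e : R => e ^+ k).
Proof.
move=> FO; apply/eqO_exP.
have /fin_all_exists[C HC] : forall ij : 'I_m * 'I_n, exists C,
    \forall e \near 0^'+, `|F e ij.1 ij.2| <= C * e ^+ k by move=> ij;
      exact: FO.
pose D := 1 + \sum_ij `|C ij|.
have D0 : 0 < D by rewrite ltr_pwDl // sumr_ge0.
exists D => //; near=> e.
have e0 : 0 < e by near: e; exact: nbhs_right_gt.
have ek : 0 <= e ^+ k by rewrite exprn_ge0 // ltW.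
rewrite [leLHS]/Num.Def.normr /= mx_normrE (ger0_norm ek).
apply: bigmax_le; first by rewrite mulr_ge0 // ltW.
move=> ij _; apply: (@le_trans _ _ (C ij * e ^+ k)).
  by move: ij; near: e; apply: filter_forall => ij; exact: HC.
apply: ler_wpM2r => //; apply: le_trans (ler_norm _) _.
by rewrite /D (bigD1 ij) //= addrCA lerDl addr_ge0 // sumr_ge0.
Unshelve. all: end_near. Qed.

Lemma eqO_coord n (F : R -> 'rV[R]_n) k l :
  F =O_ (0^'+) (fun e : R => e ^+ k) ->
  exists C, \forall e \near 0^'+, `|F e 0 l| <= C * e ^+ k.
Proof.
move=> /eqO_exP[C C0 HC]; exists C; near=> e.
have e0 : 0 < e by near: e; exact: nbhs_right_gt.
have : `|F e| <= C * `|e ^+ k| by near: e.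
rewrite (ger0_norm (exprn_ge0 _ (ltW e0))); apply: le_trans.
rewrite [leRHS]/Num.Def.normr /= mx_normrE.
exact: (le_bigmax _ (fun ij : 'I_1 * 'I_n => `|F e ij.1 ij.2|) (0, l)).
Unshelve. all: end_near. Qed.

Lemma cvg_second_order (f : R -> R) (a b C : R) :
  (\forall e \near 0^'+, `|f e - (a + e ^+ 2 * b)| <= C * e ^+ 4) ->
  (f e - a) / e ^+ 2 @[e --> 0^'+] --> b.
Proof.
move=> HC; apply/cvgrPdist_le => eps eps0.
have C1 : 0 < `|C| + 1 by rewrite ltr_wpDl.
have k0 : 0 < eps / (`|C| + 1) by rewrite divr_gt0.
near=> e.
have e0 : 0 < e by near: e; exact: nbhs_right_gt.
have e1 : e <= 1 by near: e; exact: nbhs_right_le.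
have eC : e <= eps / (`|C| + 1) by near: e; exact: nbhs_right_le.
have H : `|f e - (a + e ^+ 2 * b)| <= C * e ^+ 4 by near: e; exact: HC.
have -> : b - (f e - a) / e ^+ 2 = - (f e - (a + e ^+ 2 * b)) / e ^+ 2.
  by field; rewrite gt_eqF.
rewrite normrM normrN normfV (gtr0_norm (exprn_gt0 2 e0))
  ler_pdivrMr ?exprn_gt0 //.
apply: le_trans H _; rewrite (_ : e ^+ 4 = e ^+ 2 * e ^+ 2); last by ring.
rewrite mulrA ler_pM2r ?exprn_gt0 //.
move: eC; rewrite ler_pdivlMr //; apply: le_trans.
apply: (@le_trans _ _ (`|C| * e ^+ 2)).
  by apply: ler_wpM2r (ler_norm C); rewrite exprn_ge0 // ltW.
rewrite mulrC; apply: ler_pM => //; first by rewrite exprn_ge0 // ltW.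
  by rewrite expr2 ler_piMl // ltW.
by rewrite lerDl.
Unshelve. all: end_near. Qed.

Lemma cvg_of_second_order (f : R -> R) (a b : R) :
  (f e - a) / e ^+ 2 @[e --> 0^'+] --> b -> f e @[e --> 0^'+] --> a.
Proof.
move=> H; have He : e @[e --> (0 : R)^'+] --> (0 : R).
  apply: (@near_cvg _ _ _ (fun e => e * 1)); first by apply: nearW => e;
    rewrite mulr1.
  exact: (@expands_to_cvg R 0 _ _ 0 (@expands_to_id R 0 _ (@expandable_cst R 0
    1))).
suff : forall l, l = a + 0 * 0 * b -> f e @[e --> 0^'+] --> l by apply; ring.
move=> l ->; apply: (@near_cvg _ _ _ (fun e =>
  a + e * e * ((f e - a) / e ^+ 2))).
  move: (@nbhs_right_gt R 0); apply: filterS => e e0.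
  by field; rewrite gt_eqF.
apply: cvgD; first exact: cvg_cst.
by apply: cvgM => //; apply: cvgM.
Qed.

End MatrixLimits.

(** * Differential operators acting on jets *)

Section JetLemmas.
Variables (R : realType) (d : nat).
Implicit Types (F G : 'I_d.+1 -> R -> R) (u : nat -> R -> R).

Lemma derive1n_scale (f : R -> R) a n : bsmooth (fun _ => f) ->
  derive1n n (fun y => a * f y) = fun y => a * derive1n n f y.
Proof.
move=> Bf; elim: n => [//|n /= ->]; apply/funext => y.
exact: (@derive1Ml _ (derive1n n f) y a (@bsmooth_derivable1n R f n y Bf)).
Qed.

(** The first-order rule is applied twice, with [e * h] as the intermediate family. *)
Lemma eq_near_derive1n_second_order (f h : R -> R -> R) (c : R -> R) n :
  bsmooth (fun _ => c) -> bsmooth h ->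
    eq_near f (fun e y => c y + e ^+ 2 * h e y) ->
  eq_near (fun e => derive1n n (f e))
    (fun e y => derive1n n c y + e ^+ 2 * derive1n n (h e) y).
Proof.
move=> Bc Bh fE.
have Beh : bsmooth (fun e y => 0 + e * h e y).
  by apply: bsmooth_add; [exact: bsmooth_cst|apply: bsmooth_mul => //;
    exact: bsmooth_id].
have H1 := @eq_near_derive1n_expand R n c f (fun e y => 0 + e * h e y) Bc Beh.
have H2 := @eq_near_derive1n_expand R n (fun=> 0) (fun e y => 0 + e * h e y) h
  (bsmooth_cst 0) Bh (eq_near_refl _).
have z0 y : derive1n n (fun=> 0 : R) y = 0.
  have := @derive1n_scale (fun=> 0) 0 n (bsmooth_cst 0).
  by move=> /(congr1 (@^~ y)); rewrite (_ : (fun=> _) = fun=> 0) ?mul0r //;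
    apply/funext => z; rewrite mul0r.
have {}H1 := H1 (eq_near_trans fE (eq_nearW _)).
apply: eq_near_trans (H1 _) _ => [e y|]; first by ring.
by apply: near_loc_mono H2 => e y ->; rewrite z0; ring.
Qed.

Definition ode_op u (f : R -> R) y :=
  derive1n d.+1 f y + \sum_(i < d) u i y * derive1n i f y.

Definition jet_derivative F := coord_jet (fun l => derive1 (F l)).

(** All rows of the companion matrix but the last only shift derivatives, so [J' - U J] measures how
    far the curve is from solving the equation. *)
Lemma Umx_jet u F y k l : (jet_derivative F y - Umx d u y *m coord_jet F y)
  k l =
  if k == ord_max then ode_op u (F l) y else 0.
Proof.
rewrite mxE [X in _ + X]mxE /Umx companion_mul mxE -derive1Sn;
  case: eqP => [->|/eqP km].
  rewrite /ode_op; congr (_ + _);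
    rewrite mxE big_ord_recr /= !mxE ltnn mul0r addr0.
  rewrite -sumrN; apply: eq_bigr => i _; rewrite !mxE /= ltn_ord; ring.
rewrite mxE inordK ?subrr //.
by rewrite ltn_neqAle ltn_ord andbT eqSS -(inj_eq val_inj) in km *.
Qed.

Lemma dtUmx_jet (w : nat -> R ->
  R) F y k l : (dtUmx d w y *m coord_jet F y) k l =
  if k == ord_max then - \sum_(i < d) w i y * derive1n i (F l) y else 0.
Proof.
rewrite mxE; case: eqP => [->|/eqP km]; last first.
  by rewrite big1 // => i _; rewrite mxE (negbTE km) mul0r.
rewrite big_ord_recr /= !mxE eqxx ltnn mul0r addr0.
rewrite -sumrN; apply: eq_bigr => i _; rewrite !mxE eqxx /= ltn_ord; ring.
Qed.

End JetLemmas.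
(** * The limit of the Lax equation *)

Section Evolution.
Variables (R : realType) (d : nat) (gamma : R -> RP R d)
  (Gamma : R -> 'rV[R]_d.+1).
Hypothesis Gamma_lift : normalized_lift (fun x => line_of (gamma x)) Gamma.

Lemma coordf_lift_bsmooth l : bsmooth (fun _ => coordf Gamma l).
Proof. by have [sG _ _] := Gamma_lift; exact: smooth_coord. Qed.

Lemma det_coord_jet y : \det (coord_jet (coordf Gamma) y) = 1.
Proof. by have [sG _ dG] := Gamma_lift; rewrite -jet_coord. Qed.

Lemma coord_jet_unit y : coord_jet (coordf Gamma) y \in unitmx.
Proof. by rewrite unitmxE det_coord_jet unitr1. Qed.

(** Turns the pointwise estimate into a locally uniform expansion: [meet_of_spans] applies to the
    explicit nodes of the diagonals, and the determinant normalization controls the remaining scalar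
    factor. *)
Lemma evolved_second_order (Gt : R -> R -> 'rV[R]_d.+1) :
  (\forall e \near 0^'+, normalized_lift (short_diag_centered gamma e) (Gt e))
    ->
  (forall l, ptwise_O 2 (fun e y => coordf (Gt e) l y - coordf Gamma l y)) ->
  exists2 h : 'I_d.+1 -> R -> R -> R, (forall l, bsmooth (h l)) &
    forall l, eq_near (fun e => coordf (Gt e) l)
      (fun e y => coordf Gamma l y + e ^+ 2 * h l e y).
Proof.
move=> Gt_lift Ogt; have [sG lG dG] := Gamma_lift.
(* In units of [e], [s m] locates the planes and [t j] the points spanning one plane. *)
pose s (m : 'I_d) : R := m%:R - d.-1%:R / 2.
pose t (j : 'I_d) : R := 2 * j%:R - d.-1%:R.
have sI : injective s.
  by move=> i j /addIr/eqP; rewrite eqr_nat => /eqP/val_inj.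
have tI : injective t.
  move=> i j /addIr/eqP; rewrite (inj_eq (mulfI _)) ?pnatr_eq0 // eqr_nat.
  by move=> /eqP/val_inj.
have span : near_loc (fun e y => forall i, exists a : 'I_d ->
  R, forall l, Gt e y 0 l =
    \sum_k a k * coordf Gamma l (y + s i * e + t k * e)).
  move=> M; move: Gt_lift; apply: filterS => e [_ lt _] y _ i.
  apply: (@short_diag_centered_span _ _ gamma); first by move=> z; rewrite lG.
  by rewrite lt memv_line.
have [P EP gP] := meet_of_spans coordf_lift_bsmooth coord_jet_unit 1 sI tI span.
apply: (normalized_second_order coordf_lift_bsmooth det_coord_jet _ _ Ogt EP
  gP).
  by move: Gt_lift; apply: filterS => e [st _ _] l; exact: smooth_coord.
by move: Gt_lift; apply: filterS => e [st _ dt] y; rewrite -(jet_coord _ st).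
Qed.

Variable u : nat -> R -> R.
Hypothesis u_ode : solves_ode u Gamma.

Lemma ode_coord (v : nat -> R -> R) (F : R -> 'rV[R]_d.+1) l y :
  smooth F -> solves_ode v F -> ode_op d v (coordf F l) y = 0.
Proof.
move=> sF /(_ y)/rowP/(_ l);
  rewrite mxE [RHS]mxE (derive1n_coord _ _ _ sF) => <-.
congr (_ + _); rewrite summxE; apply: eq_bigr => i _.
by rewrite mxE (derive1n_coord _ _ _ sF).
Qed.

Lemma Umx_jet_Gamma y :
  Umx d u y *m coord_jet (coordf Gamma) y = jet_derivative (coordf Gamma) y.
Proof.
have [sG _ _] := Gamma_lift; apply/esym/eqP; rewrite -subr_eq0; apply/eqP.
by apply/matrixP => k l; rewrite Umx_jet ode_coord // mxE; case: ifP.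
Qed.

Lemma UmxE y : Umx d u y =
  jet_derivative (coordf Gamma) y *m invmx (coord_jet (coordf Gamma) y).
Proof. by rewrite -Umx_jet_Gamma mulmxK // coord_jet_unit. Qed.

Lemma mx_expands_to_Umx : mx_expands_to 0 (fun y => Umx d u y) (fun _ y =>
  Umx d u y).
Proof.
have EJ' : mx_expands_to 0 (jet_derivative (coordf Gamma)) (fun _ =>
  jet_derivative (coordf Gamma)).
  by apply: mx_expands_to_jet => l;
    exact: bsmooth_derive1 (coordf_lift_bsmooth l).
have H := mx_expands_to_mul EJ' (mx_expands_to_inv_jet coordf_lift_bsmooth
  coord_jet_unit 0).
suff -> : Umx d u = fun y => jet_derivative (coordf Gamma) y *m
    invmx (coord_jet (coordf Gamma) y) by exact: H.
by apply/funext => y; exact: UmxE.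
Qed.

(** Smoothness of the coefficients comes from [U = J' J^-1], whose last row contains [- u i]. *)
Lemma potential_smooth i : (i < d)%N -> bsmooth (fun _ => u i).
Proof.
move=> id; have i1 : (i < d.+1)%N by exact: ltn_trans id _.
have := expands_to_bsmooth (mx_expands_to_Umx ord_max (Ordinal i1)) =>
  /(bsmooth_scale (-1)).
apply: bsmooth_eq_near; apply: eq_nearW => e y.
by rewrite !mxE eqxx /= id mulN1r opprK.
Qed.

End Evolution.
(** Differentiating [V X = Y] along [X' = U X] gives [Y' = V' X + V U X], so [Y' - U Y] becomes
    [(V' + V U - U V) X]. It is used with the jets of [Gamma] and of the velocity as [X] and [Y]. *)
Lemma derivative_quotient (R : realType) n (X Y U X' Y' W V V' : 'M[R]_n) :
  X \in unitmx -> U *m X = X' -> V *m X = Y -> V' *m X + V *m X' = Y' ->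
  W *m X = Y' - U *m Y -> W = V *m U - U *m V + V'.
Proof.
move=> uX UX VX dV WX; apply: (can_inj (mulmxK uX)); rewrite WX.
rewrite mulmxDl mulmxBl -!mulmxA UX VX -dV.
by rewrite [RHS]addrC addrA.
Qed.

Theorem theorem2 (R : realType) (d : nat) (hd : (2 <= d)%N)
    (gamma : R -> RP R d)
    (gamma_smooth : smooth_curve gamma)
    (gamma_nondeg : nondegenerate_curve gamma)
    (gamma_mono : has_monodromy gamma)
    (Gamma : R -> 'rV[R]_d.+1)
    (Gamma_lift : normalized_lift (fun x => line_of (gamma x)) Gamma)
    (u : nat -> R -> R)
    (u_ode : solves_ode u Gamma)
    (Gt : R -> R -> 'rV[R]_d.+1)
    (Gt_lift : evolved_lift gamma Gamma Gt)
    (c : R)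
    (c_def : evolution_constant u Gamma Gt c)
    (w : nat -> R -> R)
    (w_def : time_derivative u Gt w)
    (x : R) :
  let L00 := fun eps => lax_L Gamma eps x 0 in
  let L01 := fun eps => lax_L (Gt eps) eps x 0 in
  let P00 := fun eps => lax_P Gamma (Gt eps) eps x 0 in
  let P10 := fun eps => lax_P Gamma (Gt eps) eps x 1 in
  let U := Umx d u in
  let V := Vmx c u Gamma in
  let lhs := fun eps : R =>
    (eps ^+ 3)^-1 *: (conjD eps (L01 eps) - conjD eps (L00 eps)) in
  let rhs := fun eps : R =>
    (eps ^+ 3)^-1 *: (conjD eps (P10 eps) *m conjD eps (L00 eps)
                        *m invmx (conjD eps (P00 eps))
                      - conjD eps (L00 eps)) in
  ((fun eps : R => conjD eps (L00 eps) - (1%:M + eps *: U x))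
     =O_ (0^'+) (fun eps : R => eps ^+ 2))
  /\
  [/\ \forall eps \near 0^'+,
        L01 eps = P10 eps *m L00 eps *m invmx (P00 eps),
      \forall eps \near 0^'+, lhs eps = rhs eps,
      lhs eps @[eps --> 0^'+] --> dtUmx d w x,
      rhs eps @[eps --> 0^'+] --> (V x *m U x - U x *m V x) + derive1 V x
    & dtUmx d w x = (V x *m U x - U x *m V x) + derive1 V x].
Proof.
move=> L00 L01 P00 P10 U V lhs rhs.
have [sG lG dG] := Gamma_lift; have [Gt_norm _] := Gt_lift;
  have [_ c_exp] := c_def.
have GB := coordf_lift_bsmooth Gamma_lift; have uJ := coord_jet_unit Gamma_lift.
set G := coordf Gamma in GB uJ.
(* Coordinates of the velocity [c Q_2 Gamma]. *)
pose H l y := c * coordf (Q2 u Gamma) l y.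
have d1 : (d.-1 < d)%N by rewrite prednK // (leq_trans _ hd).
have HQ l : coordf (Q2 u Gamma) l = fun y =>
    derive1n 2 (G l) y + 2 / d.+1%:R * u d.-1 y * G l y.
  by apply/funext => y; rewrite /coordf /Q2 !mxE derive1n_coord.
have QB l : bsmooth (fun _ => coordf (Q2 u Gamma) l).
  rewrite HQ; apply: bsmooth_add; first exact: (bsmooth_derive1n 2 (GB l)).
  apply: bsmooth_mul (GB l); apply: bsmooth_scale;
    exact: (potential_smooth Gamma_lift u_ode d1).
have HB l : bsmooth (fun _ => H l) by exact: bsmooth_scale.
have Gt_exp l y : exists C, \forall e \near 0^'+,
    `|coordf (Gt e) l y - (G l y + e ^+ 2 * H l y)| <= C * e ^+ 4.
  have [C HC] := eqO_coord l (c_exp y); exists C.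
  by move: HC; apply: filterS => e; rewrite !mxE /H /G /coordf !mxE.
have Ogt l : ptwise_O 2 (fun e y => coordf (Gt e) l y - G l y).
  move=> y; have [C HC] := Gt_exp l y; exists (`|C| + `|H l y|).
  near=> e.
  have e0 : 0 < e by near: e; exact: nbhs_right_gt.
  have e1 : e <= 1 by near: e; exact: nbhs_right_le.
  have He : `|coordf (Gt e) l y - (G l y + e ^+ 2 * H l y)| <= C * e ^+ 4.
    by near: e; exact: HC.
  have -> : coordf (Gt e) l y - G l y =
    (coordf (Gt e) l y - (G l y + e ^+ 2 * H l y)) + e ^+ 2 * H l y by ring.
  apply: le_trans (ler_normD _ _) _; rewrite mulrDl; apply: lerD.
    apply: le_trans He _; apply: (@le_trans _ _ (`|C| * e ^+ 4)).
      by apply: ler_wpM2r (ler_norm C); rewrite exprn_ge0 // ltW.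
    by apply: ler_wpM2l => //; apply: ler_wiXn2l => //; exact: ltW.
  by rewrite normrM mulrC normrX (gtr0_norm e0).
have [h hB hE] := evolved_second_order Gamma_lift Gt_norm Ogt.
rewrite -/G in hE.
(* Comparing the uniform expansion with the pointwise one: the bounded family [h] converges to the
   velocity. *)
have hH l y : h l e y @[e --> 0^'+] --> H l y.
  have [C HC] := Gt_exp l y; apply: near_cvg (cvg_second_order HC).
  have := near_loc_pt y (near_locI (hE l) (@near_loc_gt0 R));
    apply: filterS => e [-> e0].
  by rewrite -/G; field; rewrite gt_eqF.
pose hv (e y : R) : 'rV[R]_d.+1 := \row_l h l e y.
have hvE e l : coordf (hv e) l = h l e by apply/funext => y;
  rewrite /coordf mxE.
pose S (e : R) := differences Gamma e x;
  pose S' (e : R) := next_differences Gamma e x.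
pose St (e : R) := differences (Gt e) e x;
  pose St' (e : R) := next_differences (Gt e) e x.
pose Sh (e : R) := differences (hv e) e x;
  pose Sh' (e : R) := next_differences (hv e) e x.
have EG l : expands_to 0 (G l) (fun=> G l) by exact: expands_to_lead.
have EGt l : expands_to 0 (G l) (fun e => coordf (Gt e) l).
  apply: expands_to_eq_near (eq_near_sym (hE l)) _;
    apply: (@expands_to_ext _ _ (fun y => G l y + 0)).
    by move=> y; rewrite addr0.
  apply: expands_to_add => //;
    apply: (@expands_to_eq_near _ _ _ (fun e y => e * (e * h l e y))).
    by apply: eq_nearW => e y; rewrite mulrA.
  by apply: expands_to_id; apply: bsmooth_mul => //; exact: bsmooth_id.
have ES := @mx_expands_to_differences _ _ (fun _ => Gamma) _ EG.
have ES' := @mx_expands_to_next_differences _ _ (fun _ => Gamma) _ EG.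
have ESt := @mx_expands_to_differences _ _ Gt _ EGt.
have uS := mx_expands_to_unit ES uJ; have uSt := mx_expands_to_unit ESt uJ.
have St_exp : \forall e \near 0^'+,
    St e = S e + e ^+ 2 *: Sh e /\ St' e = S' e + e ^+ 2 *: Sh' e.
  (* Orders up to [d + 1] are required because of the last row of [next_differences]. *)
  have := near_loc_all (fun l => near_loc_all (fun k : 'I_d.+2 =>
    fdiffn_eq_near k (hE l))).
  move/(near_loc_pt x); apply: filterS => e He.
  have fE k l : (k < d.+2)%N -> iter k (fdiff e) (coordf (Gt e) l) x =
      iter k (fdiff e) (G l) x + e ^+ 2 * iter k (fdiff e) (h l e) x.
    move=> kd; have := He l (Ordinal kd); rewrite /fdiffn /= => ->.
    exact: (@fdiffn_add _ k (fun _ => G l) (h l) (fun e => e ^+ 2)).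
  split; apply/matrixP => k l; rewrite !mxE hvE fE //.
    exact/leqW/ltn_ord.
  exact: (ltn_ord k).
have EB : mx_expands_to 0 (fun y => Umx d u y)
    (fun e y => next_differences Gamma e y *m invmx (differences Gamma e y)).
  have := mx_expands_to_mul ES' (mx_expands_to_inv ES uJ).
  suff -> : Umx d u = fun y =>
    jet_derivative G y *m invmx (coord_jet G y) by exact.
  by apply/funext => y; exact: UmxE.
split.
  (* Part (i): the conjugated Lax matrix is [1 + e S' S^-1], and [S' S^-1] differs from [U] by [e]
     times a bounded family. *)
  apply: mx_eqO => i j; have [_ [r Br rE]] := EB i j.
  have [C HC] := bounded_ptwise_O (bsmooth_bounded Br) x; exists C.
  near=> e.
  have e0 : 0 < e by near: e; exact: nbhs_right_gt.
  have uSe : differences Gamma e x \in unitmx by near: e;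
    exact: (near_loc_pt x uS).
  have BE : (next_differences Gamma e x *m invmx (differences Gamma e x)) i j =
     Umx d u x i j + e * r e x by near: e; exact: (near_loc_pt x rE).
  have rC : `|r e x| <= C * e ^+ 0 by near: e; exact: HC.
  rewrite /L00 conjD_lax_L ?gt_eqF // opprD addrACA subrr add0r -scalerBr.
  rewrite mxE [X in _ * X]mxE BE [X in _ + X]mxE [U]/(Umx d u)
    addrAC subrr add0r.
  rewrite mulrA -expr2 normrM normrX (gtr0_norm e0) mulrC.
  by apply: ler_wpM2r; [rewrite exprn_ge0 // ltW|rewrite expr0 mulr1 in rC].
(* The common value of the limit of both sides and of the time derivative of [U]. *)
pose W := (jet_derivative H x - Umx d u x *m coord_jet H x)
  *m invmx (coord_jet G x).
have Lax : \forall e \near 0^'+, L01 e = P10 e *m L00 e *m invmx (P00 e).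
  near=> e.
  have e0 : e != 0 by rewrite gt_eqF //; near: e; exact: nbhs_right_gt.
  apply: lax_equation; apply: samples_unit => //.
  - by near: e; exact: (near_loc_pt x uS).
  - by rewrite -[e in x + e]mul1r; near: e;
    exact: (near_loc_pt x (near_loc_shift 1 uS)).
  - by near: e; exact: (near_loc_pt x uSt).
have lhs_rhs : \forall e \near 0^'+, lhs e = rhs e.
  near=> e.
  have e0 : e != 0 by rewrite gt_eqF //; near: e; exact: nbhs_right_gt.
  have u1 : samples Gamma e x \in unitmx.
    by apply: samples_unit => //; near: e; exact: (near_loc_pt x uS).
  have u2 : samples (Gt e) e x \in unitmx.
    by apply: samples_unit => //; near: e; exact: (near_loc_pt x uSt).
  have uP : P00 e \in unitmx.
    by rewrite /P00 /lax_P /sending_mx mul0r addr0 unitmx_mul u2 unitmx_inv.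
  rewrite /lhs /rhs -conjD_inv // -!conjD_mul //.
  by congr (_ *: (conjD e _ - _)); near: e; exact: Lax.
have lhs_W : mx_lim lhs W.
  (* From [St = S + e^2 Sh] and [St' = S' + e^2 Sh'] one gets [St' St^-1 - S' S^-1 = e^2 (Sh' - S'
     S^-1 Sh) St^-1]; the third factor [e] comes from [conjD L = 1 + e S' S^-1]. *)
  apply: (@mx_lim_near _ _ _ _ (fun e =>
    (Sh' e - (S' e *m invmx (S e)) *m Sh e) *m invmx (St e))).
    near=> e.
    have e0 : e != 0 by rewrite gt_eqF //; near: e; exact: nbhs_right_gt.
    have u1 : S e \in unitmx by near: e; exact: (near_loc_pt x uS).
    have u2 : St e \in unitmx by near: e; exact: (near_loc_pt x uSt).
    have [E1 E2] : St e = S e + e ^+ 2 *: Sh e /\ St' e = S' e + e ^+ 2 *: Sh'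
      e.
      by near: e.
    rewrite /lhs /L01 /L00 !conjD_lax_L // -/(S e) -/(S' e) -/(St e) -/(St' e).
    rewrite opprD addrACA subrr add0r -scalerBr scalerA.
    apply: (can_inj (mulmxK u2));
      rewrite mulmxKV // -scalemxAl mulmxBl mulmxKV //.
    rewrite E2 {1}E1 mulmxDr mulmxKV // opprD addrACA subrr add0r.
    rewrite -scalemxAr -scalerBr scalerA.
    have -> : (e ^+ 3)^-1 * e * e ^+ 2 = 1 by field; rewrite e0.
    by rewrite scale1r.
  have limSh : mx_lim Sh (coord_jet H x).
    move=> k l; rewrite mxE; apply: (@near_cvg _ _ _ (fun e =>
      fdiffn k (h l) e x)).
      by apply: nearW => e; rewrite mxE hvE.
    exact: cvg_fdiffn.
  have limSh' : mx_lim Sh' (jet_derivative H x).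
    move=> k l; rewrite mxE -derive1Sn.
    apply: (@near_cvg _ _ _ (fun e => fdiffn k.+1 (h l) e x)).
      by apply: nearW => e; rewrite mxE hvE.
    exact: cvg_fdiffn.
  apply: mx_lim_mul; last exact: (@mx_expands_to_lim _ 0 _ _ _ _ x
    (mx_expands_to_inv ESt uJ)).
  apply: mx_lim_sub => //; apply: mx_lim_mul => //.
  exact: (@mx_expands_to_lim _ 0 _ _ _ _ x EB).
have dtU_W : dtUmx d w x = W.
  have [ueps ueps_ode ueps_exp] := w_def.
  apply: (can_inj (mulmxK (uJ x))); rewrite /W mulmxKV //.
  apply/matrixP => k l; rewrite dtUmx_jet Umx_jet; case: ifP => // _.
  have dw (i : 'I_d) : (ueps e i x - u i x) / e ^+ 2 @[e --> 0^'+] --> w i x.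
    have /eqO_exP[C _ HC] := ueps_exp i x (ltn_ord i).
    apply: (@cvg_second_order _ _ _ _ C); near=> e.
    have e0 : 0 < e by near: e; exact: nbhs_right_gt.
    have : `|ueps e i x - (u i x + e ^+ 2 * w i x)| <= C * `|e ^+ 4| by near: e.
    by rewrite normrX (gtr0_norm e0).
  have hn n := @cvg_derive1n _ n (h l) (H l) (hB l) (HB l) (hH l) x.
  (* This is the difference of the equations for [Gt e] and [Gamma], divided by [e^2]. It is
     therefore 0 for small [e], and its limit gives the linearized equation, which determines the
     last row of [dtUmx] times the jet. *)
  have Z : \sum_(i < d) (ueps e i x - u i x) / e ^+ 2 * derive1n i (G l) x +
     (derive1n d.+1 (h l e) x + \sum_(i < d) ueps e i x * derive1n i (h l e) x)
     @[e --> 0^'+] -->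
     \sum_(i < d) w i x * derive1n i (G l) x + ode_op d u (H l) x.
    apply: cvgD; first by apply: cvg_sumr => i; apply: cvgM;
      [exact: dw|exact: cvg_cst].
    apply: cvgD; first exact: hn.
    by apply: cvg_sumr => i; apply: cvgM;
      [exact: (cvg_of_second_order (dw i))|exact: hn].
  apply/eqP; rewrite eq_sym -addr_eq0 addrC; apply/eqP.
  apply: (cvg_unique (@Rhausdorff R) Z); apply: (@near_cvg _ _ _ (fun=> 0));
    last exact: cvg_cst.
  have Gn := near_loc_all (fun i : 'I_d.+2 =>
    eq_near_derive1n_second_order i (GB l) (hB l) (hE l)).
  near=> e.
  have e0 : e != 0 by rewrite gt_eqF //; near: e; exact: nbhs_right_gt.
  have ode1 : ode_op d (ueps e) (coordf (Gt e) l) x = 0.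
    have [st _ _] : normalized_lift (short_diag_centered gamma e) (Gt e)
      by near: e.
    by apply: ode_coord => //; near: e.
  have ode0 : ode_op d u (G l) x = 0 by exact: ode_coord.
  have He (i : 'I_d.+2) : derive1n i (coordf (Gt e) l) x =
      derive1n i (G l) x + e ^+ 2 * derive1n i (h l e) x.
    by move: i; near: e; exact: (near_loc_pt x Gn).
  have Hd i : (i < d.+2)%N -> derive1n i (coordf (Gt e) l) x =
      derive1n i (G l) x + e ^+ 2 * derive1n i (h l e) x.
    by move=> id; exact: (He (Ordinal id)).
  have e2 : e ^+ 2 != 0 by rewrite expf_neq0.
  have sumE : \sum_(i < d) ueps e i x * derive1n i (coordf (Gt e) l) x =
      \sum_(i < d) u i x * derive1n i (G l) x +
      (\sum_(i < d) e ^+ 2 * ((ueps e i x - u i x) / e ^+ 2 * derive1n i (G l)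
        x) +
       \sum_(i < d) e ^+ 2 * (ueps e i x * derive1n i (h l e) x)).
    rewrite -!big_split; apply: eq_bigr => i _ /=.
    by rewrite Hd; [field|exact/leqW/leqW/ltn_ord].
  move: ode1; rewrite /ode_op sumE Hd // => ode1.
  have cancel (p q s0 s1 s2 : R) :
      p + q + (s0 + (s1 + s2)) = 0 -> p + s0 = 0 -> s1 + (q + s2) = 0.
    by move=> H1 H2; rewrite -[RHS]H1 -[LHS]addr0 -H2; ring.
  by apply: (mulfI e2); rewrite mulr0 !mulrDr !mulr_sumr;
    exact: cancel ode1 ode0.
(* As a quotient of jets, [V] is smooth and fits [derivative_quotient], which identifies [W] with
   the zero-curvature expression. *)
have VE : V = fun y => coord_jet H y *m invmx (coord_jet G y).
  have sQ : smooth (Q2 u Gamma) by exact: coord_smooth.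
  apply/funext => y; rewrite /V /Vmx /sending_mx (jet_coord y sQ)
    (jet_coord y sG).
  suff -> : c *: coord_jet (coordf (Q2 u Gamma)) y = coord_jet H y by [].
  by apply/matrixP => k l; rewrite !mxE (derive1n_scale c k (QB l)).
have VB i j : bsmooth (fun _ y => V y i j).
  have EH : mx_expands_to 0 (coord_jet H) (fun _ =>
    coord_jet H) by exact: mx_expands_to_jet.
  by rewrite VE; exact: (expands_to_lead_bsmooth (mx_expands_to_mul EH
    (mx_expands_to_inv_jet GB uJ 0) i j)).
have VJ y : V y *m coord_jet G y = coord_jet H y by rewrite VE mulmxKV.
have dV : derivable V x 1.
  by apply/derivable_mxP => i j;
    exact: (@bsmooth_derivable R (fun y => V y i j) x (VB i j)).
have W_V : W = V x *m U x - U x *m V x + derive1 V x.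
  apply: (@derivative_quotient _ _ (coord_jet G x) (coord_jet H x) _
    (jet_derivative G x) (jet_derivative H x)) => //.
  - exact: Umx_jet_Gamma.
  - apply/matrixP => i j; rewrite [RHS]mxE -derive1Sn /=.
    have JE : derive1n i (H j) = fun y => \sum_k V y i k * derive1n k (G j) y.
      apply/funext => y; transitivity (coord_jet H y i j); first by rewrite mxE.
      by rewrite -VJ mxE; apply: eq_bigr => k _; congr (_ * _); rewrite mxE.
    rewrite JE; symmetry; apply: is_derive_derive1.
    rewrite 3!mxE -big_split /=; apply: is_derive_fsum => k.
    have dk : is_derive x 1 (fun y => V y i k) (derive1 V x i k).
      by rewrite derive1_mx //; exact/derivable_is_derive/bsmooth_derivable.
    have dGk : is_derive x 1 (derive1n k (G j)) (derive1n k.+1 (G j) x).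
      exact/derivable_is_derive/bsmooth_derivable1n.
    apply: (is_derive_eq (is_deriveM dk dGk)).
    rewrite [coord_jet G x k j]mxE [jet_derivative G x k j]mxE -derive1Sn.
    by rewrite addrC; congr (_ + _); exact: mulrC.
  - by rewrite /W mulmxKV.
split=> //.
- by rewrite dtU_W; exact: mx_lim_cvg.
- rewrite -W_V; apply: near_cvg (mx_lim_cvg lhs_W).
  by move: lhs_rhs; apply: filterS => e ->.
- by rewrite dtU_W.
Unshelve. all: end_near. Qed.
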